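(* Let $0<c<1$ be fixed. Then the sequence of functions $\xi_n:S_n\to\{0,1\}$ defined by $$\xi_n:=\mathbb 1_{\{\pi\in S_n:\ \text{the length of the largest cycle in }\pi\text{ is at least }cn\}}$$ is noise sensitive with respect to the interchange process on the complete graph $K_n$.
   Context: $S_n$ is the group of permutations of $[n]=\{1,\dots,n\}$ under composition. The interchange process on the complete graph $K_n$ is the continuous-time Markov chain on $S_n$ with generator $(Qf)(\pi)=\nu\sum_{1\le i<j\le n}\big(f(\pi\,(i,j))-f(\pi)\big)$, where $\nu>0$ is a constant rate. It is reversible and irreducible with uniform stationary distribution. Relaxation time: $t_{\rm rel}=1/\theta_1$, where $\theta_1$ is the smallest positive eigenvalue of $-Q$. A sequence $f_n:S_n\to\{0,1\}$ is noise sensitive with respect to reversible irreducible continuous-time Markov chains $X_n(t)$ on $S_n$ with stationary distributions $\pi_n$ and relaxation times $t^n_{\rm rel}$ if for all $\alpha>0$, $\lim_{n\to\infty}\mathrm{Cov}\big(f_n(X_n(0)),f_n(X_n(\alpha t^n_{\rm rel}))\big)=0$, where $X_n(0)\sim\pi_n$. *)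

(* Defs.v *)
From HB Require Import structures.
From mathcomp Require Import all_boot all_order all_algebra all_fingroup.
From mathcomp Require Import all_classical all_reals all_analysis.

Set Implicit Arguments.
Unset Strict Implicit.
Unset Printing Implicit Defensive.

Import Order.TTheory GRing.Theory Num.Theory.
Import numFieldNormedType.Exports.

Local Open Scope classical_set_scope.
Local Open Scope ring_scope.

Section MarkovChains.
Variables (R : realType) (T : finType).
Implicit Types (Q : 'End({ffun T -> R^o})) (x y : T) (t : R).

Definition indic_pt y : {ffun T -> R^o} := [ffun z => (z == y)%:R].

(* The matrix entry Q(x, y): the jump rate from x to y when x != y. *)
Definition rate Q x y : R := Q (indic_pt y) x.

Record reversible_chain := ReversibleChain {
  generator :> 'End({ffun T -> R^o});
  stationary : T -> R;
  _ : forall x y, x != y -> 0 <= rate generator x y;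
  _ : forall x, \sum_y rate generator x y = 0;
  _ : forall x, 0 <= stationary x;
  _ : \sum_x stationary x = 1;
  _ : forall x y, stationary x * rate generator x y =
                  stationary y * rate generator y x;
  _ : forall x y,
        connect [rel u v | (u != v) && (0 < rate generator u v)] x y }.

(* p_t(x, y) = (e^{tQ} 1_y)(x), with e^{tQ} given by its power series. *)
Definition transition Q t x y : R :=
  limn (series (fun k : nat => t ^+ k / k`!%:R * iter k Q (indic_pt y) x)).

(* [path_prob Q t x [:: (t1, x1); ...; (tk, xk)]] is the probability
   p_{t1 - t}(x, x1) p_{t2 - t1}(x1, x2) ... *)
Fixpoint path_prob Q t x (s : seq (R * T)) : R :=
  if s is (u, y) :: s' then transition Q (u - t) x y * path_prob Q u y s'
  else 1.

Definition smallest_positive_eigenvalue (A : 'End({ffun T -> R^o})) : set R :=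
  [set theta | [/\ 0 < theta, passmx.leigenvalue A theta &
     forall lam, 0 < lam -> passmx.leigenvalue A lam -> theta <= lam]].

(* The default value 0 of [xget] is reached only if there is no positive
   eigenvalue, that is, when the state space is a singleton. *)
Definition relaxation_time (C : reversible_chain) : R :=
  (xget 0 (smallest_positive_eigenvalue (- generator C)))^-1.

(* The process (X t), t >= 0, is the chain C started from its stationary
   distribution, specified through its finite-dimensional distributions.  No
   regularity of the sample paths is required.  *)
Definition stationary_version (C : reversible_chain) (d : measure_display)
    (Omega : measurableType d) (P : probability Omega R)
    (X : R -> Omega -> T) : Prop :=
  (forall t x, 0 <= t -> measurable [set w | X t w = x]) /\
  (forall x (s : seq (R * T)), path <=%R 0 (unzip1 s) ->
     P [set w | X 0 w = x /\ forall p, p \in s -> X p.1 w = p.2] =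
     (stationary C x * path_prob C 0 x s)%:E).

End MarkovChains.

Definition noise_sensitive (R : realType)
    (C : forall n : nat, reversible_chain R 'S_n)
    (f : forall n : nat, 'S_n -> bool) : Prop :=
  forall alpha : R, 0 < alpha ->
  forall (d : nat -> measure_display) (Omega : forall n, measurableType (d n))
    (P : forall n, probability (Omega n) R)
    (X : forall n, R -> Omega n -> 'S_n),
  (forall n, stationary_version (C n) (P n) (X n)) ->
  covariance (P n) (fun w => (f n (X n 0 w))%:R)
    (fun w => (f n (X n (alpha * relaxation_time (C n)) w))%:R)
    @[n --> \oo] --> 0%E.

Section Interchange.
Variables (R : realType) (nu : R) (n : nat).

(* In MathComp, [(s * t)%g] applies [s] first, so the composition of pi with
   the transposition (i, j) acting first is [(tperm i j * pi)%g]. *)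
Definition interchange_op (f : {ffun 'S_n -> R^o}) : {ffun 'S_n -> R^o} :=
  [ffun pi : 'S_n => nu * \sum_(i < n) \sum_(j < n | (i < j)%N)
                       (f (tperm i j * pi)%g - f pi)].

Lemma interchange_op_linear : linear interchange_op.
Proof.
move=> a f g; apply/ffunP => p; rewrite !ffunE.
rewrite scalerAr -mulrDr; congr (_ * _).
rewrite scaler_sumr -big_split /=; apply: eq_bigr => i _.
rewrite scaler_sumr -big_split /=; apply: eq_bigr => j _.
by rewrite !ffunE scalerBr opprD addrACA.
Qed.

HB.instance Definition _ := GRing.isLinear.Build R {ffun 'S_n -> R^o}
  {ffun 'S_n -> R^o} *:%R interchange_op interchange_op_linear.

Definition interchange_gen : 'End({ffun 'S_n -> R^o}) := linfun interchange_op.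

Lemma interchange_rateE (p q : 'S_n) :
  rate interchange_gen p q = nu * \sum_(i < n) \sum_(j < n | (i < j)%N)
    ((tperm i j * p == q)%g%:R - (p == q)%:R).
Proof.
rewrite /rate lfunE /= ffunE; congr (_ * _).
by apply: eq_bigr => i _; apply: eq_bigr => j _; rewrite !ffunE.
Qed.

Lemma interchange_rateC (p q : 'S_n) :
  rate interchange_gen p q = rate interchange_gen q p.
Proof.
rewrite !interchange_rateE; congr (_ * _).
apply: eq_bigr => i _; apply: eq_bigr => j _; rewrite [q == p]eq_sym.
congr (_%:R - _); congr nat_of_bool.
by apply/eqP/eqP => <-; rewrite mulgA tperm2 mul1g.
Qed.

Hypothesis nu_gt0 : 0 < nu.

Lemma interchange_rate_ge0 (p q : 'S_n) :
  p != q -> 0 <= rate interchange_gen p q.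
Proof.
move=> /negbTE pq; rewrite interchange_rateE pq mulr_ge0 ?(ltW nu_gt0) //.
by apply: sumr_ge0 => i _; apply: sumr_ge0 => j _; rewrite subr0 ler0n.
Qed.

Lemma interchange_rate_sum (p : 'S_n) :
  \sum_q rate interchange_gen p q = 0.
Proof.
under eq_bigr do rewrite interchange_rateE.
rewrite -mulr_sumr exchange_big /= big1 ?mulr0 // => i _.
rewrite exchange_big /= big1 // => j _.
have sum1 (r : 'S_n) : \sum_q (r == q)%:R = 1 :> R.
  rewrite (bigD1 r) //= eqxx big1 ?addr0 // => q.
  by rewrite eq_sym => /negbTE ->.
by rewrite big_split /= sumrN !sum1 subrr.
Qed.

Lemma uniform_ge0 (p : 'S_n) : 0 <= (#|{: 'S_n}|%:R)^-1 :> R.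
Proof. by rewrite invr_ge0 ler0n. Qed.

Lemma uniform_sum : \sum_(p : 'S_n) (#|{: 'S_n}|%:R)^-1 = 1 :> R.
Proof.
rewrite sumr_const -[LHS]mulr_natr mulVf // pnatr_eq0 -lt0n.
by apply/card_gt0P; exists 1%g.
Qed.

Lemma interchange_rate_gt0 (p : 'S_n) (i j : 'I_n) : i != j ->
  (p != tperm i j * p)%g && (0 < rate interchange_gen p (tperm i j * p)%g).
Proof.
wlog lt_ij : i j / (i < j)%N => [wl|] ij.
  have [lt_ij|lt_ji|/val_inj eij] := ltngtP i j; first exact: wl.
    by rewrite tpermC; apply: (wl j i lt_ji); rewrite eq_sym.
  by move: ij; rewrite eij eqxx.
set q := (tperm i j * p)%g; have /negbTE pq : p != q.
  apply: contraNneq ij => /(congr1 (fun r : 'S_n => r * p^-1)%g).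
  by rewrite /q mulgK mulgV => /permP /(_ i); rewrite perm1 tpermL => ->.
rewrite pq interchange_rateE pq mulr_gt0 // (bigD1 i) //= (bigD1 j) //=.
rewrite eqxx subr0 -addrA ltr_pwDl ?ltr01 // addr_ge0 //.
  by apply: sumr_ge0 => k _; rewrite subr0 ler0n.
by apply: sumr_ge0 => k _; apply: sumr_ge0 => l _; rewrite subr0 ler0n.
Qed.

Lemma interchange_irreducible (p q : 'S_n) :
  connect [rel u v | (u != v) && (0 < rate interchange_gen u v)] p q.
Proof.
have [ts eq_ts ts_pair] := prod_tpermP (q * p^-1)%g.
have {eq_ts} -> : q = ((\prod_(t <- ts) tperm t.1 t.2) * p)%g.
  by rewrite -eq_ts mulgKV.
elim: ts ts_pair => [|t ts IH] /=; first by rewrite big_nil mul1g.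
move=> /andP[t_pair /IH /connect_trans]; apply.
by rewrite big_cons -mulgA; apply: connect1; apply: interchange_rate_gt0.
Qed.

Definition interchange_chain : reversible_chain R 'S_n :=
  @ReversibleChain R 'S_n interchange_gen (fun=> (#|{: 'S_n}|%:R)^-1)
    interchange_rate_ge0 interchange_rate_sum uniform_ge0 uniform_sum
    (fun p q => congr1 _ (interchange_rateC p q)) interchange_irreducible.

End Interchange.

Definition largest_cycle (n : nat) (p : 'S_n) : nat :=
  \max_(O in porbits p) #|O|.

Definition xi (R : realType) (c : R) (n : nat) (p : 'S_n) : bool :=
  c * n%:R <= (largest_cycle p)%:R.

(* Main.v *)
Require Import Defs.
From mathcomp Require Import all_boot all_order all_algebra all_fingroup.
From mathcomp Require Import all_classical all_reals all_analysis.
From mathcomp Require Import complex zify ring lra.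

Set Implicit Arguments.
Unset Strict Implicit.
Unset Printing Implicit Defensive.

Import Order.TTheory GRing.Theory Num.Theory.
Import numFieldNormedType.Exports.

Local Open Scope ring_scope.

(** Let [Q] be the generator, [f] the indicator of a cycle of length at least
    [c * n], and [u = e^(tQ) f] with [t = alpha * t_rel].  The covariance to be
    bounded is the covariance of [f] and [u] under the uniform law of ['S_n].

    First, a random transposition hardly changes [u].  The function
    [p |-> (p 0 == 0) - 1 / n] is an eigenfunction of [- Q] for the eigenvalue
    [nu * n], so that [t] is at least [alpha / (nu * n)]
    ([relaxation_time_ge]).  By the spectral theorem the semigroup brings the
    Dirichlet energy of [f] below [1 / (2t)] ([transition_dirichlet]), which is
    of order [n]; this energy is shared by about [n ^ 2 / 2] transpositions, so
    the mean change of [u] under a random transposition is of order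
    [n ^ (-1/2)] ([interchange_jump_bound]).

    Next, fix [delta > 0] and call a cycle big when its length is at least
    [delta * n].  There are at most [1 / delta] big cycles, and a proportion at
    least [delta ^ 2] of the pairs of points lies in two given big cycles, hence
    merges them.  Merging all the big cycles of [p] into one therefore uses a
    bounded number of transpositions whose law has a bounded density with
    respect to uniform ones: in mean it changes [u] by [o(1)].  Since [u]
    commutes with conjugation, its value after the merger is a function [v] of
    the small cycles of [p] ([merging_approx]).

    Finally, the largest cycle is nearly independent of the cycles shorter than
    [delta * n].  The cycle through a given point has a uniform length, and the
    rest is a uniform permutation of the remaining points
    ([cycle_mean_size_bias]).  This recursion shows that the law of the small
    cycles hardly depends on the number of points, and then, by a Gronwall
    argument, that the covariance of [f] and of [v] of the small cycles is small
    with [delta] ([large_small_cov]).  Letting [n] go to infinity and then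
    [delta] to [0] concludes. *)

(** * Spectral resolution of a symmetric generator *)

(** The matrix is diagonalized by a unitary matrix over [R[i]].  Its eigenvalues
    are real, so the real parts of the complex eigenprojections still resolve
    the identity and still consist of eigenvectors.  They need not be
    idempotent, but they stay positive: the associated quadratic form is a
    squared modulus. *)
Lemma spectral_resolution_mx (R : rcfType) (m : nat) (K : 'M[R]_m) :
  K^T = K ->
  exists (lam : 'I_m -> R) (E : 'I_m -> 'M[R]_m),
    [/\ forall i, (E i)^T = E i, \sum_i E i = 1%:M,
        forall i, K *m E i = lam i *: E i &
        forall i (g : 'rV_m), 0 <= (g *m E i *m g^T) 0 0].
Proof.
move=> symK; pose C := R[i].
pose A : 'M[C]_m := map_mx (real_complex R) K.
have hermA : A \is hermsymmx.
  apply: realsym_hermsym.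
    apply/is_hermitianmxP; rewrite expr0 scale1r map_mx_id //.
    by rewrite /A map_trmx symK.
  by apply/mxOverP => i j; rewrite mxE complex_real.
have realD := hermitian_spectral_diag_real hermA.
have /hermitian_normalmx/orthomx_spectralP := hermA.
rewrite invmx_unitary ?spectral_unitarymx //.
set P := spectralmx A; set d := spectral_diag A => eqA.
have uP : P \is unitarymx by exact: spectral_unitarymx.
have ReD (a b : C) : complex.Re (a + b) = complex.Re a + complex.Re b.
  by case: a b => [? ?] [? ?].
have ReM (a : R) (b : C) :
    complex.Re (real_complex R a * b) = a * complex.Re b.
  by case: b => x y /=; rewrite mul0r subr0.
have ReJ (a : C) : complex.Re (a^*) = complex.Re a.
  by case: a.
have Re_sum (I : finType) (F : I -> C) :
    complex.Re (\sum_i F i) = \sum_i complex.Re (F i).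
  exact: (big_morph _ ReD).
pose F i x y : C := (P i x)^* * P i y.
have FE i x y : F i x y = (P^t* *m delta_mx i i *m P)%sesqui x y.
  rewrite mxE (bigD1 i) //= [X in _ = _ + X]big1 => [|k /negPf nk].
    rewrite addr0 mxE (bigD1 i) //= big1 => [|k /negPf nk].
      by rewrite !mxE !eqxx addr0 mulr1.
    by rewrite !mxE nk mulr0.
  by rewrite mxE big1 ?mul0r // => l _; rewrite !mxE nk andbF mulr0.
have [_ PP] : P^t*%sesqui *m P = 1%:M /\ P *m P^t*%sesqui = 1%:M.
  split; last exact/unitarymxP.
  have := uP; rewrite -trmxC_unitary => /unitarymxP.
  by rewrite trmxCK.
have dE i : real_complex R (complex.Re (d 0 i)) = d 0 i.
  by apply: RRe_real; move/mxOverP: realD; apply.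
exists (fun i => complex.Re (d 0 i)), (fun i => \matrix_(x, y) complex.Re (F i x y)).
split.
- move=> i; apply/matrixP => x y; rewrite !mxE -ReJ; congr complex.Re.
  by rewrite rmorphM /= conjCK mulrC.
- apply/matrixP => x y; rewrite summxE.
  under eq_bigr do rewrite mxE.
  rewrite -Re_sum.
  have := uP; rewrite -trmxC_unitary => /unitarymxP; rewrite trmxCK.
  move=> /matrixP /(_ x y); rewrite !mxE => e.
  have -> : \sum_i F i x y = (x == y)%:R.
    by rewrite -e; apply: eq_bigr => i _; rewrite !mxE.
  by case: (x == y).
- move=> i; apply/matrixP => x y; rewrite !mxE.
  under eq_bigr => z _ do rewrite mxE -ReM.
  rewrite -Re_sum -ReM dE; congr complex.Re.
  have -> : \sum_z real_complex R (K x z) * F i z y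
      = (A *m (P^t* *m delta_mx i i *m P)%sesqui) x y.
    by rewrite mxE; apply: eq_bigr => z _; rewrite FE [A x z]mxE.
  rewrite eqA -!mulmxA (mulmxA P) PP mul1mx (mulmxA (diag_mx d)).
  have -> : diag_mx d *m delta_mx i i = d 0 i *: delta_mx i i.
    apply/matrixP => k l; rewrite mul_diag_mx !mxE.
    by case: (k =P i) => [->|] //=; rewrite !mulr0.
  by rewrite -scalemxAl -scalemxAr mulmxA mxE FE.
- move=> i g; rewrite mxE.
  pose s := \sum_y real_complex R (g 0 y) * P i y.
  have -> : \sum_y (g *m (\matrix_(x, z) complex.Re (F i x z))) 0 y * g^T y 0
      = complex.Re (s^* * s).
    transitivity (\sum_y \sum_x complex.Re (real_complex R (g 0 y) *
      (real_complex R (g 0 x) * F i x y))).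
      apply: eq_bigr => y _; rewrite !mxE big_distrl /=.
      by apply: eq_bigr => x _; rewrite !ReM mxE mulrC.
    rewrite /s rmorph_sum /= big_distrl /= exchange_big /= Re_sum.
    apply: eq_bigr => x _; rewrite big_distrr /= Re_sum; apply: eq_bigr => y _.
    congr complex.Re; rewrite rmorphM /F /=.
    have -> : (real_complex R (g 0 x))^* = real_complex R (g 0 x).
      by apply/CrealP; rewrite complex_real.
    ring.
  have : 0 <= s^* * s by rewrite mulrC mul_conjC_ge0.
  by rewrite lecE => /andP[].
Qed.

Lemma spectral_resolution (R : rcfType) (T : finType) (K : T -> T -> R) :
  (forall x y, K x y = K y x) ->
  exists (m : nat) (lam : 'I_m -> R) (E : 'I_m -> T -> T -> R),
    [/\ forall i x y, E i x y = E i y x,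
        forall x y, \sum_i E i x y = (x == y)%:R,
        forall i x z, \sum_y K x y * E i y z = lam i * E i x z &
        forall i (g : T -> R), 0 <= \sum_x \sum_y g x * E i x y * g y].
Proof.
move=> symK.
pose A : 'M[R]_#|T| := \matrix_(a, b) K (enum_val a) (enum_val b).
have sumT (F : T -> R) : \sum_x F x = \sum_(a < #|T|) F (enum_val a).
  by rewrite -big_enum_val; apply: eq_bigl => x; rewrite inE.
have [|lam [E [symE sumE eigE posE]]] := @spectral_resolution_mx R _ A.
  by apply/matrixP => a b; rewrite !mxE.
exists #|T|, lam, (fun i x y => E i (enum_rank x) (enum_rank y)); split.
- by move=> i x y; rewrite -[in LHS](symE i) mxE.
- move=> x y; have /matrixP/(_ (enum_rank x) (enum_rank y)) := sumE.
  by rewrite summxE mxE (inj_eq enum_rank_inj).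
- move=> i x z; have /matrixP/(_ (enum_rank x) (enum_rank z)) := eigE i.
  rewrite !mxE => <-; rewrite sumT; apply: eq_bigr => a _.
  by rewrite !mxE enum_rankK enum_valK.
- move=> i g; have := posE i (\row_a g (enum_val a)); congr (0 <= _).
  rewrite mxE exchange_big sumT /=; apply: eq_bigr => a _.
  rewrite !mxE sumT big_distrl /=; apply: eq_bigr => b _.
  by rewrite !mxE !enum_valK.
Qed.

Section SymmetricGenerator.
Variables (R : realType) (T : finType) (Q : 'End({ffun T -> R^o})).
Hypothesis rateC : forall x y, rate Q x y = rate Q y x.

Lemma generatorE (g : {ffun T -> R^o}) x : Q g x = \sum_y rate Q x y * g y :> R.
Proof.
have {1}-> : g = \sum_y g y *: indic_pt R y.
  apply/ffunP => z; rewrite sum_ffunE (bigD1 z) //= big1 => [|y yz].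
    by rewrite !ffunE eqxx addr0 [RHS]mulr1.
  by rewrite !ffunE eq_sym (negPf yz) [LHS]mulr0.
rewrite linear_sum sum_ffunE; apply: eq_bigr => y _.
by rewrite linearZ ffunE [LHS]mulrC.
Qed.

Variables (m : nat) (lam : 'I_m -> R) (E : 'I_m -> T -> T -> R).
Hypothesis E_sym : forall i x y, E i x y = E i y x.
Hypothesis E_sum : forall x y, \sum_i E i x y = (x == y)%:R.
Hypothesis E_eig : forall i x z, \sum_y rate Q x y * E i y z = lam i * E i x z.

(** Powers, and hence the exponential series, act on the resolution through the
    eigenvalues. *)
Lemma iter_generatorE k x y :
  iter k Q (indic_pt R y) x = \sum_i lam i ^+ k * E i x y :> R.
Proof.
have step j (w : T -> R) z : (forall z', w z' = \sum_i lam i ^+ j * E i z' y) ->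
    \sum_z' rate Q z z' * w z' = \sum_i lam i ^+ j.+1 * E i z y.
  move=> wE; under eq_bigr do rewrite wE mulr_sumr.
  rewrite exchange_big /=; apply: eq_bigr => i _.
  rewrite exprSr -mulrA -E_eig mulr_sumr.
  by apply: eq_bigr => z' _; rewrite mulrCA.
elim: k x => [|k IH] x /=.
  by rewrite ffunE -E_sum; apply: eq_bigr => i _; rewrite expr0 mul1r.
by rewrite generatorE; apply: step => z; apply: IH.
Qed.

Lemma transitionE t x y :
  transition Q t x y = \sum_i expR (t * lam i) * E i x y.
Proof.
apply: cvg_lim => //.
have -> : series (fun k => t ^+ k / k`!%:R * iter k Q (indic_pt R y) x) =
    (fun n => \sum_i series (exp_coeff (t * lam i)) n * E i x y).
  apply/funext => n; rewrite /series /=.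
  under eq_bigr do rewrite iter_generatorE big_distrr /=.
  rewrite exchange_big /=; apply: eq_bigr => i _; rewrite big_distrl /=.
  apply: eq_bigr => k _; rewrite /exp_coeff /= exprMn; ring.
apply: (cvg_big (@add_continuous _)) => i _; apply: cvgMr_tmp.
exact: is_cvg_series_exp_coeff.
Qed.

Lemma transition_sym t x y : transition Q t x y = transition Q t y x.
Proof. by rewrite !transitionE; apply: eq_bigr => i _; rewrite E_sym. Qed.


Let act (F : T -> T -> R) (g : T -> R) x := \sum_y F x y * g y.

Let act_sym F (g h : T -> R) : (forall x y, F x y = F y x) ->
  \sum_x act F g x * h x = \sum_x g x * act F h x.
Proof.
move=> symF; under eq_bigr do rewrite mulr_suml.
rewrite exchange_big /=; apply: eq_bigr => y _; rewrite mulr_sumr.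
by apply: eq_bigr => x _; rewrite symF; ring.
Qed.

Let act_sum F (g : 'I_m -> T -> R) x :
  act F (fun y => \sum_i g i y) x = \sum_i act F (g i) x.
Proof.
by rewrite /act; under eq_bigr do rewrite mulr_sumr; rewrite exchange_big.
Qed.

Let act_scale F (a : R) (g : T -> R) x :
  act F (fun y => a * g y) x = a * act F g x.
Proof. by rewrite /act mulr_sumr; apply: eq_bigr => y _; rewrite mulrCA. Qed.

Let act_id (f : T -> R) x : f x = \sum_i act (E i) f x.
Proof.
rewrite /act exchange_big /= (bigD1 x) //= -mulr_suml E_sum eqxx mul1r.
by rewrite big1 ?addr0 // => y yx; rewrite -mulr_suml E_sum eq_sym (negPf yx) mul0r.
Qed.

Let rate_act i f x : act (rate Q) (act (E i) f) x = lam i * act (E i) f x.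
Proof.
rewrite /act; under eq_bigr do rewrite mulr_sumr.
rewrite exchange_big mulr_sumr /=; apply: eq_bigr => z _.
by rewrite mulrA -E_eig mulr_suml; apply: eq_bigr => y _; rewrite mulrA.
Qed.

Let transition_act t f x :
  act (transition Q t) f x = \sum_i expR (t * lam i) * act (E i) f x.
Proof.
rewrite /act; under eq_bigr do rewrite transitionE mulr_suml.
rewrite exchange_big /=; apply: eq_bigr => i _; rewrite mulr_sumr.
by apply: eq_bigr => y _; rewrite mulrA.
Qed.

(** [lam i * E i (E j f) = E i (Q (E j f)) = lam j * E i (E j f)] by symmetry. *)
Let E_act_orth i j f x : lam i != lam j -> act (E i) (act (E j) f) x = 0.
Proof.
move=> lam_ij; apply/eqP.
suff : (lam i - lam j) * act (E i) (act (E j) f) x == 0.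
  by rewrite mulf_eq0 subr_eq0 (negPf lam_ij).
rewrite mulrBl subr_eq0; apply/eqP; rewrite -[RHS]act_scale.
transitivity (act (E i) (act (rate Q) (act (E j) f)) x); last first.
  by rewrite {1}/act; apply: eq_bigr => y _; rewrite rate_act.
rewrite /act mulr_sumr.
under [RHS]eq_bigr do rewrite mulr_sumr.
rewrite exchange_big /=; apply: eq_bigr => y _.
rewrite mulrA (E_sym i x) -E_eig mulr_suml; apply: eq_bigr => z _.
by rewrite (E_sym i z) (rateC y); ring.
Qed.

Let transition_E_act t i f x :
  act (transition Q t) (act (E i) f) x = expR (t * lam i) * act (E i) f x.
Proof.
rewrite transition_act [act (E i) f x]act_id mulr_sumr; apply: eq_bigr => j _.
have [->//|/E_act_orth ->] := eqVneq (lam j) (lam i).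
by rewrite !mulr0.
Qed.

(** With [w i] the mass of [f] on [E i], the energy of [e^(tQ) f] is the sum of
    [- lam i * e^(2 t lam i) * w i], and [y * e^(- y) <= 1] at
    [y = - 2 t lam i]. *)
Lemma transition_dirichlet (f u : T -> R) (t : R) : 0 < t ->
  (forall i, 0 <= \sum_x \sum_y f x * E i x y * f y) ->
  (forall x, u x = \sum_y transition Q t x y * f y) ->
  - (\sum_x u x * \sum_y rate Q x y * u y) <= (2 * t)^-1 * \sum_x f x ^+ 2.
Proof.
move=> t0 posE uE.
pose e i := expR (t * lam i).
pose w i := \sum_x f x * act (E i) f x.
have w_ge0 i : 0 <= w i.
  have := posE i; congr (0 <= _); apply: eq_bigr => x _.
  by rewrite mulr_sumr; apply: eq_bigr => y _; rewrite mulrA.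
have -> : \sum_x u x * (\sum_y rate Q x y * u y) = \sum_i e i ^+ 2 * lam i * w i.
  have rE x : \sum_y rate Q x y * u y = \sum_i e i * lam i * act (E i) f x.
    transitivity (act (rate Q) (fun y => \sum_i e i * act (E i) f y) x).
      by apply: eq_bigr => y _; rewrite uE -transition_act.
    rewrite act_sum; apply: eq_bigr => i _.
    by rewrite act_scale rate_act mulrA.
  under eq_bigr do rewrite rE uE -/(act (transition Q t) f _).
  rewrite act_sym; last exact: transition_sym.
  transitivity (\sum_x \sum_i f x * (e i ^+ 2 * lam i * act (E i) f x)).
    apply: eq_bigr => x _; rewrite act_sum mulr_sumr; apply: eq_bigr => i _.
    by rewrite act_scale transition_E_act -/(e i); ring.
  rewrite exchange_big /=; apply: eq_bigr => i _; rewrite mulr_sumr.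
  by apply: eq_bigr => x _; rewrite mulrCA.
have -> : \sum_x f x ^+ 2 = \sum_i w i.
  rewrite exchange_big /=; apply: eq_bigr => x _.
  by rewrite -mulr_sumr -act_id expr2.
rewrite -sumrN mulr_sumr; apply: ler_sum => i _.
rewrite -mulNr ler_wpM2r // -[leRHS]div1r ler_pdivlMr ?mulr_gt0 //.
have : 1 - 2 * t * lam i <= expR (- (2 * t * lam i)) by apply: expR_ge1Dx.
have -> : e i ^+ 2 = (expR (- (2 * t * lam i)))^-1.
  by rewrite -expRN opprK expr2 -expRD; congr expR; ring.
have := expR_gt0 (- (2 * t * lam i)); set z := expR _ => z0 le_z.
rewrite (_ : _ * _ = (- (2 * t * lam i)) / z); last by field; rewrite gt_eqF.
by rewrite ler_pdivrMr // mul1r; lra.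
Qed.

End SymmetricGenerator.

(** * Cycle types, merging and conjugacy *)

(** The cycle lengths come in an arbitrary order, so statements about cycle
    types are up to [perm_eq], and only functions invariant under it matter. *)
Definition cycle_type (T : finType) (p : {perm T}) : seq nat :=
  [seq #|B| | B : {set T} <- enum (porbits p)].

Definition symmetric_fun (U : Type) (Phi : seq nat -> U) :=
  forall s t, perm_eq s t -> Phi s = Phi t.

Section CycleType.
Variable T : finType.
Implicit Types (p q s : {perm T}) (x y z : T).

Lemma porbit_mul_tperm_notin p x y z :
  x \notin porbit p z -> y \notin porbit p z ->
  porbit (tperm x y * p)%g z = porbit p z.
Proof.
move=> nx ny.
suff exp_id i : ((tperm x y * p) ^+ i)%g z = (p ^+ i)%g z.
  by apply/setP => u; apply/porbitP/porbitP => -[i ->]; exists i.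
elim: i => // i IH; rewrite !expgSr !permM IH tpermD //.
  by apply: contraNneq nx => ->; apply: mem_porbit.
by apply: contraNneq ny => ->; apply: mem_porbit.
Qed.

(** The number of orbits given by [porbits_mul_tperm] shows that [x] and [y]
    become related; every other orbit is untouched, so that the orbit of [x] is
    exactly the union of the two old ones. *)
Lemma porbit_merge p x y : x \notin porbit p y ->
  porbit (tperm x y * p)%g x = porbit p x :|: porbit p y.
Proof.
move=> nxy; set q := (tperm x y * p)%g.
have xy : x != y by apply: contraNneq nxy => ->; apply: porbit_id.
have xqy : x \in porbit q y.
  have := porbits_mul_tperm q x y; have := porbits_mul_tperm p x y.
  rewrite /= -/q {2}/q tpermKg nxy xy; case: (x \in _) => //=.
  lia.
have qxy : porbit q x = porbit q y by apply/eqP; rewrite eq_porbit_mem.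
apply/setP => z; rewrite inE; apply/idP/idP => [zq|].
  apply: contraLR zq; rewrite negb_or ![z \in _]porbit_sym => /andP[nx ny].
  by rewrite /q porbit_mul_tperm_notin.
apply: contraLR; rewrite porbit_sym => nx.
have ny : y \notin porbit q z.
  by move: nx; rewrite porbit_sym qxy porbit_sym.
rewrite negb_or ![z \in _]porbit_sym.
have <- : porbit q z = porbit p z.
  by rewrite -(porbit_mul_tperm_notin nx ny) /q tpermKg.
by rewrite nx ny.
Qed.

(** The two merged lengths are put back on the left-hand side so as to avoid
    subtraction of multisets. *)
Lemma cycle_type_merge p x y : x \notin porbit p y ->
  perm_eq (#|porbit p x| :: #|porbit p y| :: cycle_type (tperm x y * p)%g)
          (#|porbit p x| + #|porbit p y| :: cycle_type p)%N.
Proof.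
move=> nxy; set X := porbit p x; set Y := porbit p y; set q := (_ * p)%g.
have XY : X != Y by rewrite eq_porbit_mem.
have dXY : [disjoint X & Y].
  rewrite -setI_eq0; apply: contraNT nxy => /set0Pn[z].
  by rewrite inE -!eq_porbit_mem => /andP[/eqP <- /eqP <-].
pose rest := porbits p :\ X :\ Y.
have ep : perm_eq (enum (porbits p)) (X :: Y :: enum rest).
  apply: uniq_perm; rewrite ?enum_uniq //=.
    by rewrite !inE !mem_enum !inE !eqxx /= enum_uniq andbF orbF XY.
  move=> O; rewrite !inE !mem_enum !inE.
  have [->|_] := eqVneq O X; first by rewrite imset_f.
  by have [->|_] := eqVneq O Y; first by rewrite imset_f.
have qx : porbit q x = X :|: Y by exact: porbit_merge.
have qy : porbit q y = X :|: Y.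
  by rewrite finset.setUC /q tpermC; apply: porbit_merge; rewrite porbit_sym.
have notXY z : z \notin X -> z \notin Y -> porbit q z = porbit p z.
  by move=> zX zY; apply: porbit_mul_tperm_notin; rewrite porbit_sym.
have eq : perm_eq (enum (porbits q)) (X :|: Y :: enum rest).
  apply: uniq_perm; rewrite ?enum_uniq //=.
    rewrite mem_enum !inE enum_uniq andbT negb_and negb_and !negbK.
    apply/orP; right; apply/orP; right; apply/imsetP => -[z _ zXY].
    have : x \in porbit p z by rewrite -zXY inE porbit_id.
    have : y \in porbit p z by rewrite -zXY inE porbit_id orbT.
    rewrite -!eq_porbit_mem => /eqP <-; rewrite eq_porbit_mem.
    by rewrite (negPf nxy).
  move=> O; rewrite !inE !mem_enum !inE; apply/imsetP/orP.
    case=> z _ ->; have [zX|zX] := boolP (z \in X); [left | have [zY|zY] := boolP (z \in Y); [left|right]].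
    - by rewrite -qx eq_porbit_mem qx inE zX.
    - by rewrite -qx eq_porbit_mem qx inE zY orbT.
    - by rewrite notXY // imset_f // !eq_porbit_mem zX zY.
  case=> [/eqP->|/and3P[OY OX /imsetP[z _ Oz]]]; first by exists x.
  exists z => //; rewrite notXY // -eq_porbit_mem -Oz //.
rewrite /cycle_type.
have -> : (#|X| + #|Y| = #|X :|: Y|)%N.
  by rewrite cardsU disjoint_setI0 // cards0 subn0.
rewrite (perm_trans (y := [:: #|X|, #|Y|, #|X :|: Y| & [seq #|B| | B : {set T} <- enum rest]])) //.
  by rewrite !perm_cons (perm_map (fun B : {set T} => #|B|) eq).
rewrite perm_sym (perm_trans (y := [:: #|X :|: Y|, #|X|, #|Y| & [seq #|B| | B : {set T} <- enum rest]])) //.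
  by rewrite perm_cons (perm_map (fun B : {set T} => #|B|) ep).
apply/seq.permP => a /=; lia.
Qed.

Lemma sum_cycle_type (R : pzSemiRingType) p (g : nat -> R) :
  \sum_x g #|porbit p x| = \sum_(l <- cycle_type p) l%:R * g l.
Proof.
rewrite big_map big_enum /= (partition_big (porbit p) (mem (porbits p))) /=; last first.
  by move=> x _; apply: imset_f.
apply: eq_bigr => _ /imsetP[x _ ->].
rewrite (eq_bigr (fun=> g #|porbit p x|)) => [|y /eqP->] //.
rewrite sumr_const mulr_natl; congr (_ *+ _); apply: eq_card => y.
by rewrite -eq_porbit_mem.
Qed.

End CycleType.

Section Conjugacy.
Variable T : finType.
Implicit Types (p q s : {perm T}) (x y z : T).

Lemma eq_perm_exp p y i j :
  ((p ^+ i)%g y == (p ^+ j)%g y) = (i == j %[mod #|porbit p y|]).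
Proof.
set m := #|porbit p y|; have m0 : (0 < m)%N by rewrite lt0n card_porbit_neq0.
have pm : (p ^+ m)%g y = y by rewrite permX iter_porbit.
have modE k : (p ^+ k)%g y = nth y (traject p y m) (k %% m).
  rewrite nth_traject ?ltn_pmod // -permX {1}(divn_eq k m) expgD permM mulnC expgM.
  congr ((p ^+ _)%g _); elim: (k %/ m)%N => [|d IH]; first by rewrite perm1.
  by rewrite expgS permM pm IH.
rewrite !modE nth_uniq ?size_traject ?ltn_pmod //.
exact: uniq_traject_porbit.
Qed.

(** The permutation of indices that matches the two lists of lengths matches the
    orbits themselves. *)
Lemma porbits_size_bijection p q : perm_eq (cycle_type p) (cycle_type q) ->
  exists2 phi : {set T} -> {set T}, {in porbits p &, injective phi} &
    {in porbits p, forall B, phi B \in porbits q /\ #|phi B| = #|B|}.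
Proof.
move=> /(perm_iotaP 0%N)[Is pIs eIs].
set sp := enum (porbits p); set sq := enum (porbits q).
have szI : size Is = size sp by rewrite -[RHS](size_map (fun B : {set T} => #|B|)) -/(cycle_type p) eIs size_map.
have szq : size (cycle_type q) = size sq by rewrite size_map.
have mem_sp B : (B \in sp) = (B \in porbits p) by rewrite mem_enum.
have ltI B : B \in porbits p -> (index B sp < size Is)%N.
  by move=> Bp; rewrite szI index_mem mem_sp.
have ltq B : B \in porbits p -> (nth 0%N Is (index B sp) < size sq)%N.
  by move=> /ltI lt; rewrite -szq -[(_ < _)%N](mem_iota 0) -(perm_mem pIs) mem_nth.
exists (fun B => nth finset.set0 sq (nth 0%N Is (index B sp))).
  move=> B B' Bp B'p /eqP; rewrite nth_uniq ?enum_uniq ?ltq //.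
  rewrite nth_uniq ?ltI // ?(perm_uniq pIs) ?iota_uniq // => /eqP e.
  by rewrite -(nth_index finset.set0 (_ : B \in sp)) ?mem_sp // e nth_index // mem_sp.
move=> B Bp; split; first by rewrite -mem_enum mem_nth ?ltq.
have := congr1 (fun l => nth 0%N l (index B sp)) eIs.
rewrite (nth_map 0%N) ?ltI //.
rewrite /cycle_type (nth_map finset.set0) ?index_mem ?mem_sp //.
rewrite (nth_map finset.set0); last exact: ltq.
by rewrite nth_index ?mem_sp // => <-.
Qed.

(** A representative [y] is chosen in each orbit of [p], and a representative [z]
    in the matching orbit of [q].  The conjugator sends [p ^+ i y] to
    [q ^+ i z]; this makes sense because the two orbits have the same length,
    hence the exponents [i] agree modulo the same number. *)
Lemma eq_cycle_type_conj p q : perm_eq (cycle_type p) (cycle_type q) ->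
  exists s, q = (p ^ s)%g.
Proof.
move=> /porbits_size_bijection[phi phi_inj phiP].
have [x0|T0] := pickP T; last first.
  by exists 1%g; apply/permP => x; have := T0 x.
pose rep (B : {set T}) := odflt x0 [pick x in B].
have repP (t : {perm T}) B : B \in porbits t -> porbit t (rep B) = B.
  move=> /imsetP[x _ ->]; apply/eqP; rewrite eq_porbit_mem /rep.
  by case: pickP => // /(_ x); rewrite porbit_id.
have Pp x : porbit p x \in porbits p by exact: imset_f.
pose y x := rep (porbit p x); pose z x := rep (phi (porbit p x)).
have zP x : porbit q (z x) = phi (porbit p x).
  by apply: repP; have [] := phiP _ (Pp x).
have card_z x : #|porbit q (z x)| = #|porbit p (y x)|.
  by rewrite zP /y repP //; have [] := phiP _ (Pp x).
have ex_i x : exists i, x == (p ^+ i)%g (y x).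
  have : x \in porbit p (y x) by rewrite /y repP // porbit_id.
  by case/porbitP => i e; exists i; apply/eqP.
pose i x := xchoose (ex_i x).
have iP x : (p ^+ i x)%g (y x) = x by apply/esym/eqP; exact: (xchooseP (ex_i x)).
pose f x := (q ^+ i x)%g (z x).
have f_orbit x : porbit q (f x) = phi (porbit p x) by rewrite porbit_perm zP.
have f_eqv x : f (p x) = q (f x).
  have oE : porbit p (p x) = porbit p x by have := porbit_perm p 1 x; rewrite expg1.
  have zE : z (p x) = z x by rewrite /z oE.
  have yE : y (p x) = y x by rewrite /y oE.
  rewrite /f zE -permM -expgSr; apply/eqP.
  by rewrite eq_perm_exp card_z -eq_perm_exp -{1}yE iP expgSr permM iP.
have f_inj : injective f.
  move=> x x' e; have := f_orbit x; rewrite e f_orbit => /phi_inj.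
  move=> /(_ (Pp _) (Pp _)) oE.
  have zE : z x' = z x by rewrite /z oE.
  have yE : y x' = y x by rewrite /y oE.
  move/eqP: e; rewrite /f zE eq_perm_exp card_z -eq_perm_exp iP -yE iP.
  by move/eqP.
exists (perm f_inj); apply/permP => u.
rewrite -(permKV (perm f_inj) u) permJ !permE f_eqv.
by rewrite -[f _]permE.
Qed.

End Conjugacy.

(** * The cycle type of a uniform permutation *)

Lemma perm_eq_rem (U : eqType) (x : U) (s t : seq U) :
  perm_eq s t -> perm_eq (rem x s) (rem x t).
Proof.
move=> st; have [xs|xs] := boolP (x \in s).
  rewrite -(perm_cons x); have xt : x \in t by rewrite -(perm_mem st).
  rewrite -(permPl (perm_to_rem xs)) (perm_trans st) //.
  exact: perm_to_rem.
by rewrite !rem_id // -(perm_mem st).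
Qed.

Section CycleMean.
Variable R : realType.
Implicit Types (n : nat) (Phi : seq nat -> R).

Definition cycle_mean n Phi : R :=
  (n`!%:R)^-1 * \sum_(p : 'S_n) Phi (cycle_type p).

Lemma porbit_lift_perm n (s : 'S_n) (y : 'I_n) :
  porbit (lift_perm ord0 ord0 s) (lift ord0 y) = lift ord0 @: porbit s y.
Proof.
have exp_lift i : ((lift_perm ord0 ord0 s) ^+ i)%g (lift ord0 y) =
    lift ord0 ((s ^+ i)%g y).
  elim: i => [|i IH]; first by rewrite !expg0 !perm1.
  by rewrite !expgSr !permM IH lift_perm_lift.
apply/setP => u; apply/porbitP/imsetP => [[i ->]|[v /porbitP[i ->] ->]].
  by exists ((s ^+ i)%g y); rewrite ?mem_porbit.
by exists i.
Qed.

Lemma porbit_lift_perm0 n (s : 'S_n) :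
  porbit (lift_perm ord0 ord0 s) ord0 = [set ord0]%SET.
Proof.
apply/setP => u; rewrite inE; apply/porbitP/eqP => [[i ->]|->]; last first.
  by exists 0%N; rewrite expg0 perm1.
elim: i => [|i IH]; first by rewrite expg0 perm1.
by rewrite expgSr permM IH lift_perm_id.
Qed.

Lemma cycle_type_lift_perm n (s : 'S_n) :
  perm_eq (cycle_type (lift_perm ord0 ord0 s)) (1%N :: cycle_type s).
Proof.
have inj_lift : injective (fun B : {set 'I_n} => lift (@ord0 n) @: B).
  exact/imset_inj/lift_inj.
have e : perm_eq (enum (porbits (lift_perm ord0 ord0 s)))
    ([set ord0]%SET :: [seq lift (@ord0 n) @: B | B : {set 'I_n} <- enum (porbits s)]).
  apply: uniq_perm => [||B]; rewrite ?enum_uniq //=.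
    rewrite map_inj_uniq // enum_uniq andbT; apply/mapP => -[B].
    rewrite mem_enum => /imsetP[y _ ->] /finset.setP /(_ (lift ord0 y)).
    by rewrite inE imset_f ?porbit_id.
  rewrite mem_enum inE; apply/imsetP/orP.
    case=> x _ ->; have [y ->|->] := unliftP ord0 x; last first.
      by left; rewrite porbit_lift_perm0.
    right; apply/mapP; exists (porbit s y); rewrite ?mem_enum ?imset_f //.
    exact: porbit_lift_perm.
  case=> [/eqP->|/mapP[B']]; first by exists ord0; rewrite ?porbit_lift_perm0.
  rewrite mem_enum => /imsetP[y _ ->] ->.
  by exists (lift ord0 y); rewrite ?porbit_lift_perm.
rewrite (perm_trans (perm_map (fun B : {set _} => #|B|) e)) //= cards1.
rewrite perm_cons -map_comp /cycle_type.
rewrite (eq_map (g := fun B : {set 'I_n} => #|B|)) // => B /=.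
by rewrite card_imset //; apply: lift_inj.
Qed.

(** A permutation of [n + 1] points is a permutation of [n] points into which the
    new point [ord0] is inserted, either as a fixed point ([x = ord0]) or into
    the cycle of [x]. *)
Lemma sum_perm_insert n (F : 'S_n.+1 -> R) :
  \sum_p F p = \sum_(x : 'I_n.+1) \sum_(s : 'S_n)
    F (tperm ord0 x * lift_perm ord0 ord0 s)%g.
Proof.
pose f (u : 'I_n.+1 * 'S_n) := (tperm ord0 u.1 * lift_perm ord0 ord0 u.2)%g.
have f_inj : injective f.
  move=> [x s] [x' s'] /= e.
  have xE : x = x'.
    apply: (@perm_inj _ (f (x, s))); rewrite [in RHS]e /f /=.
    by rewrite !permM !tpermR !lift_perm_id.
  move: e; rewrite /f xE /= => /mulgI /permP e; congr pair; apply/permP => y.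
  by have := e (lift ord0 y); rewrite !lift_perm_lift => /lift_inj.
rewrite pair_big /= (reindex f); last first.
  apply: onW_bij; apply: inj_card_bij => //.
  by rewrite card_prod !card_ord !card_Sn factS.
by [].
Qed.

(** One step of the Chinese restaurant process: the new point opens a cycle, or
    joins a cycle of length [l], which it can do in [l] ways. *)
Definition insert_sum Phi (mu : seq nat) : R :=
  Phi (1%N :: mu) + \sum_(l <- mu) l%:R * Phi (l.+1 :: rem l mu).

Lemma cycle_mean_insert n Phi : symmetric_fun Phi ->
  n.+1%:R * cycle_mean n.+1 Phi = cycle_mean n (insert_sum Phi).
Proof.
move=> symPhi; rewrite /cycle_mean factS natrM invfM !mulrA.
rewrite divff ?pnatr_eq0 // mul1r; congr (_ * _).
rewrite sum_perm_insert exchange_big /=; apply: eq_bigr => s _.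
rewrite big_ord_recl tperm1 mul1g; congr (_ + _).
  exact/symPhi/cycle_type_lift_perm.
rewrite -(sum_cycle_type s (fun l => Phi (l.+1 :: rem l (cycle_type s)))).
apply: eq_bigr => y _; apply: symPhi.
set x := lift ord0 y; set q := lift_perm _ _ s.
have nx : ord0 \notin porbit q x.
  rewrite porbit_lift_perm; apply/imsetP => -[z _ /eqP].
  by rewrite (negPf (neq_lift _ _)).
have := cycle_type_merge nx.
rewrite porbit_lift_perm0 cards1 porbit_lift_perm card_imset; last exact: lift_inj.
set l := #|porbit s y|; set ct' := cycle_type _ => e.
have {}e : perm_eq [:: 1%N, l & ct'] [:: l.+1, 1%N & cycle_type s].
  apply: (perm_trans e); rewrite add1n perm_cons; exact: cycle_type_lift_perm.
have {e} : perm_eq (l :: ct') (l.+1 :: cycle_type s).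
  rewrite -(perm_cons 1%N) (perm_trans e) //.
  by apply/seq.permP => a /=; lia.
have l0 : (0 < l)%N by rewrite lt0n card_porbit_neq0.
move=> /(perm_eq_rem l); rewrite /= eqxx.
by rewrite gtn_eqF.
Qed.

Lemma symmetric_insert_sum Phi : symmetric_fun Phi -> symmetric_fun (insert_sum Phi).
Proof.
move=> symPhi s t st; rewrite /insert_sum; congr (_ + _).
  by apply: symPhi; rewrite perm_cons.
rewrite (perm_big _ st) /=; apply: eq_bigr => l _; congr (_ * _).
by apply: symPhi; rewrite perm_cons; apply: perm_eq_rem.
Qed.

Lemma insert_sum_cons Phi l mu : symmetric_fun Phi ->
  insert_sum Phi (l :: mu) =
  l%:R * Phi (l.+1 :: mu) + insert_sum (fun nu => Phi (l :: nu)) mu.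
Proof.
move=> symPhi; rewrite /insert_sum big_cons /= eqxx addrCA; congr (_ + (_ + _)).
  by apply: symPhi; apply/seq.permP => a /=; lia.
rewrite big_seq [RHS]big_seq; apply: eq_bigr => k k_mu; congr (_ * _).
apply: symPhi; case: eqP => [->|_].
  rewrite (perm_trans _ (_ : perm_eq [:: k.+1, k & rem k mu] _)) //.
    by rewrite perm_cons; apply: perm_to_rem.
  by apply/seq.permP => a /=; lia.
by apply/seq.permP => a /=; lia.
Qed.

(** The cycle through a given point has a uniform length [i + 1], and what remains
    is a uniform permutation of the other points.  The proof is by induction:
    both sides obey the same Chinese restaurant recursion, the distinguished
    cycle of length [l] accounting for the term [l%:R * Phi (l.+1 :: mu)] of
    [insert_sum_cons]. *)
Lemma cycle_mean_size_bias n Phi : symmetric_fun Phi ->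
  n.+1%:R * cycle_mean n.+1 Phi =
  \sum_(i < n.+1) cycle_mean (n - i) (fun mu => Phi (i.+1 :: mu)).
Proof.
have sym_cons (Psi : seq nat -> R) l : symmetric_fun Psi -> symmetric_fun (fun mu => Psi (l :: mu)).
  by move=> symPsi s t st; apply: symPsi; rewrite perm_cons.
have meanD k (F G : seq nat -> R) a : cycle_mean k (fun mu => a * F mu + G mu) =
    a * cycle_mean k F + cycle_mean k G.
  by rewrite /cycle_mean big_split /= -mulr_sumr mulrDr mulrCA.
elim: n Phi => [|n IH] Phi symPhi; rewrite cycle_mean_insert //.
  rewrite big_ord1 subn0; congr (_ * _); apply: eq_bigr => s _.
  have -> : cycle_type s = [::].
    apply: size0nil; rewrite size_map -cardE; apply/eqP; rewrite cards_eq0.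
    by apply/eqP/finset.setP => B; rewrite inE; apply/imsetP => -[[]].
  by rewrite /insert_sum big_nil addr0.
have n1 : n.+1%:R != 0 :> R by rewrite pnatr_eq0.
apply: (mulfI n1); rewrite IH; last exact: symmetric_insert_sum.
pose U l := cycle_mean (n.+1 - l) (fun mu => Phi (l.+1 :: mu)).
transitivity (\sum_(i < n.+1) (i.+1%:R * U i.+1 + (n.+1 - i)%:R * U i)).
  apply: eq_bigr => i _.
  transitivity (cycle_mean (n - i) (fun mu => i.+1%:R * Phi (i.+2 :: mu) +
      insert_sum (fun nu => Phi (i.+1 :: nu)) mu)).
    by congr (_ * _); apply: eq_bigr => s _; apply: insert_sum_cons.
  have i_n : (i <= n)%N by rewrite -ltnS.
  rewrite meanD -cycle_mean_insert; last exact: sym_cons.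
  by rewrite /U subSS subSn.
rewrite big_split /= mulr_sumr.
under [RHS]eq_bigr do rewrite -/(U _).
have -> : \sum_(i < n.+1) i.+1%:R * U i.+1 = \sum_(i < n.+2) i%:R * U i.
  by rewrite [RHS]big_ord_recl mul0r add0r.
have -> : \sum_(i < n.+1) (n.+1 - i)%:R * U i = \sum_(i < n.+2) (n.+1 - i)%:R * U i.
  by rewrite [RHS]big_ord_recr /= subnn mul0r addr0.
rewrite -big_split /=; apply: eq_bigr => i _.
by rewrite -mulrDl -natrD subnKC // -ltnS.
Qed.

End CycleMean.

(** * Near independence of large and small cycles *)

Section CycleMeanTheory.
Variable R : realType.
Implicit Types (n : nat) (F G : seq nat -> R).

Lemma le_cycle_mean n F G : (forall mu, F mu <= G mu) ->
  cycle_mean n F <= cycle_mean n G.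
Proof.
by move=> FG; rewrite ler_wpM2l ?invr_ge0 ?ler0n //; apply: ler_sum.
Qed.

Lemma cycle_mean_cst n (a : R) : cycle_mean n (fun=> a) = a.
Proof.
rewrite /cycle_mean sumr_const card_Sn -[a *+ _]mulr_natl mulrA mulVf ?mul1r //.
Qed.

Lemma cycle_mean_linear n (a : R) F G :
  cycle_mean n (fun mu => F mu + a * G mu) = cycle_mean n F + a * cycle_mean n G.
Proof. by rewrite /cycle_mean big_split /= -mulr_sumr mulrDr mulrCA. Qed.

Lemma ler_norm_cycle_mean n F (a : R) : (forall mu, `|F mu| <= a) ->
  `|cycle_mean n F| <= a.
Proof.
move=> Fa; rewrite ler_norml -{1}(cycle_mean_cst n a) -{2}(cycle_mean_cst n a).
have -> : - cycle_mean n (fun=> a) = cycle_mean n (fun=> - a).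
  by rewrite !cycle_mean_cst.
by rewrite !le_cycle_mean // => mu; have := Fa mu; rewrite ler_norml => /andP[].
Qed.

End CycleMeanTheory.

Lemma sum_indicator_lt (R : realType) (n : nat) (D : R) : 0 <= D ->
  \sum_(i < n) (i.+1%:R < D)%R%:R <= D.
Proof.
move=> D0; elim: n => [|n IH]; first by rewrite big_ord0.
rewrite big_ord_recr /=; case: ltP => [lt|_]; last by rewrite addr0.
apply: le_trans (ltW lt); rewrite -[leRHS]natr1 lerD2r.
rewrite -[X in _ <= X%:R]card_ord -[leRHS]sumr_const.
by apply: ler_sum => i _; case: (_ < _).
Qed.

Section Independence.
Variables (R : realType) (D A : R) (v : seq nat -> R).
Hypotheses (D_ge0 : 0 <= D) (A_gt0 : 0 < A) (DA : D <= A).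
Hypothesis v_sym : symmetric_fun v.
Hypothesis v_ge0 : forall mu, 0 <= v mu.
Hypothesis v_le1 : forall mu, v mu <= 1.

Let small (mu : seq nat) := [seq l <- mu | l%:R < D].
Let large (mu : seq nat) := has (fun l => A <= l%:R) mu.

Let h n : R := cycle_mean n (fun mu => v (small mu)).
Let pr n : R := cycle_mean n (fun mu => (large mu)%:R).
Let G n : R := cycle_mean n (fun mu => (large mu)%:R * v (small mu)).

Let sym_small : symmetric_fun (fun mu => v (small mu)).
Proof. by move=> s t st; apply: v_sym; apply: perm_filter. Qed.

Let sym_large : symmetric_fun (fun mu => (large mu)%:R : R).
Proof. by move=> s t st; rewrite /large (perm_has _ st). Qed.

Let sym_both : symmetric_fun (fun mu => (large mu)%:R * v (small mu)).
Proof. by move=> s t st; rewrite (sym_small st) (sym_large st). Qed.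

Let h_ge0 n : 0 <= h n.
Proof. by rewrite -(cycle_mean_cst n 0) le_cycle_mean. Qed.

Let h_le1 n : h n <= 1.
Proof. by rewrite -(cycle_mean_cst n 1) le_cycle_mean. Qed.

Let sum_rev n (F : nat -> R) : \sum_(i < n.+1) F (n - i)%N = \sum_(i < n.+1) F i.
Proof.
rewrite (reindex_inj rev_ord_inj) /=; apply: eq_bigr => i _; congr F.
by have := ltn_ord i; lia.
Qed.

(** Equality would hold if the length of the first cycle were never below [D];
    there are at most [D] exceptional lengths, each costing at most [1]. *)
Let h_step n : `|n.+1%:R * h n.+1 - \sum_(r < n.+1) h r| <= D.
Proof.
rewrite /h cycle_mean_size_bias // -(sum_rev n h) -sumrB.
apply: le_trans (ler_norm_sum _ _ _) _.
apply: le_trans (sum_indicator_lt n.+1 D_ge0); apply: ler_sum => i _.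
case: ltP => lt; last first.
  by rewrite /small /= ltNge lt /= subrr normr0.
have -> (x y : R) : x - y = x + (-1) * y by rewrite mulN1r.
rewrite -cycle_mean_linear; apply: ler_norm_cycle_mean => mu.
have := v_ge0 (small (i.+1 :: mu)); have := v_le1 (small (i.+1 :: mu)).
have := v_ge0 (small mu); have := v_le1 (small mu).
by rewrite ler_norml /=; lra.
Qed.

Let avg n := (\sum_(r < n) h r) / n%:R.

Let h_avg n : `|h n.+1 - avg n.+1| <= D / n.+1%:R.
Proof.
have n0 : 0 < n.+1%:R :> R by rewrite ltr0n.
rewrite /avg ler_pdivlMr // -[X in _ * X]gtr0_norm // -normrM mulrBl.
by rewrite divfK ?gt_eqF // mulrC h_step.
Qed.

(** The averages satisfy
    [avg (n + 1) - avg n = (h n - avg n) / (n + 1)], of size at most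
    [D / (n * (n + 1)) = D / n - D / (n + 1)]: the differences telescope. *)
Let avg_close m n : (m <= n)%N -> `|avg n.+1 - avg m.+1| <= D / m.+1%:R - D / n.+1%:R.
Proof.
elim: n => [|n IH]; first by rewrite leqn0 => /eqP->; rewrite !subrr normr0.
rewrite leq_eqVlt => /orP[/eqP->|]; first by rewrite !subrr normr0.
rewrite ltnS => /IH {}IH.
have n0 : 0 < n.+1%:R :> R by rewrite ltr0n.
have n1 : 0 < n.+2%:R :> R by rewrite ltr0n.
have nS : n.+2%:R = n.+1%:R + 1 :> R by rewrite natr1.
have : `|avg n.+2 - avg n.+1| <= D / n.+1%:R - D / n.+2%:R.
  have -> : avg n.+2 - avg n.+1 = (h n.+1 - avg n.+1) / n.+2%:R.
    rewrite /avg big_ord_recr /=; move: n0 n1; rewrite nS; move: (n.+1%:R : R).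
    by move=> a a0 a1; field; rewrite !gt_eqF.
  rewrite normrM (@ger0_norm _ (_^-1)) ?invr_ge0 ?(ltW n1) //.
  rewrite ler_pdivrMr //; apply: le_trans (h_avg n) _.
  rewrite mulrBl divfK ?gt_eqF // nS mulrDr mulr1 divfK ?gt_eqF //.
  by rewrite addrAC subrr add0r.
move: IH; move: (D / _) (D / _) (D / _) => a b e.
rewrite !ler_norml => /andP[? ?] /andP[? ?]; apply/andP; split; lra.
Qed.

(** The law of the small cycles depends little on the number of points, as long
    as it is large with respect to [D]. *)
Let h_close m n : (0 < m)%N -> (m <= n)%N -> `|h m - h n| <= 3 * D / m%:R.
Proof.
case: m n => // m [//|n] _; rewrite ltnS => mn.
have := h_avg m; have := h_avg n; have := avg_close mn.
have n0 : 0 <= D / n.+1%:R by rewrite divr_ge0 ?ler0n.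
have : D / n.+1%:R <= D / m.+1%:R.
  by rewrite ler_wpM2l // lef_pV2 ?posrE ?ltr0n // ler_nat.
rewrite -mulrA; move: (D / m.+1%:R) (D / n.+1%:R) n0 => a b.
rewrite !ler_norml => ? ? /andP[? ?] /andP[? ?] /andP[? ?].
apply/andP; split; lra.
Qed.

Let large_small_n n (p : 'S_n) : n%:R < A -> large (cycle_type p) = false.
Proof.
move=> nA; apply/negP => /hasP[l /mapP[B _ ->]]; apply/negP; rewrite -ltNge.
apply: le_lt_trans nA; rewrite ler_nat.
by rewrite -[leqRHS]card_ord max_card.
Qed.

Variables (N : nat) (M : R).
Hypotheses (M_gt0 : 0 < M) (AN : A <= N%:R).

Let g n := G n - pr n * h N.

Let g_eq0 n : n%:R < A -> g n = 0.
Proof.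
move=> nA; rewrite /g /G /pr /cycle_mean !big1 ?mulr0 ?mul0r ?subrr // => p _;
by rewrite large_small_n // mul0r.
Qed.

(** The size-biased recursion for [g], according to the length of the first cycle:
    below [D] it costs at most [1]; between [D] and [A] it leaves [g] at a
    smaller number of points; from [A] on, the event is realized and only
    [h r - h N] remains. *)
Let g_step n : n.+1%:R * `|g n.+1| <=
  \sum_(r < n.+1) `|g r| + (D + \sum_(r < n.+1) `|h r - h N|).
Proof.
have -> : n.+1%:R * `|g n.+1| =
    `|n.+1%:R * G n.+1 - n.+1%:R * pr n.+1 * h N|.
  by rewrite -mulrA -mulrBr normrM ger0_norm.
rewrite (cycle_mean_size_bias n sym_both) (cycle_mean_size_bias n sym_large).
rewrite mulr_suml -sumrB -(sum_rev n (fun r => `|g r|)).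
rewrite -(sum_rev n (fun r => `|h r - h N|)).
apply: le_trans (ler_norm_sum _ _ _) _.
apply: (@le_trans _ _ (\sum_(i < n.+1)
   (`|g (n - i)| + ((i.+1%:R < D)%R%:R + `|h (n - i)%N - h N|)))); last first.
  by rewrite !big_split /= lerD2l lerD2r sum_indicator_lt.
apply: ler_sum => i _.
have -> (x y z : R) : x - y * z = x + - z * y by rewrite mulNr [z * y]mulrC.
rewrite -cycle_mean_linear; have [lt|ge] := ltP (i.+1%:R : R) D.
  apply: (@le_trans _ _ 1); last first.
    by rewrite addrCA lerDl addr_ge0.
  apply: ler_norm_cycle_mean => mu.
  have := v_ge0 (small (i.+1 :: mu)); have := v_le1 (small (i.+1 :: mu)).
  have := h_ge0 N; have := h_le1 N; move: (h N) (v _) => a b.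
  rewrite ler_norml; move: (large (i.+1 :: mu)) => -[] /=; lra.
have sm mu : small (i.+1 :: mu) = small mu by rewrite /small /= ltNge ge.
have [geA|ltA] := leP A (i.+1%:R : R).
  rewrite mulr0n add0r; apply: (@le_trans _ _ `|h (n - i) - h N|); last by rewrite lerDr.
  have -> : cycle_mean (n - i) (fun mu => (large (i.+1 :: mu))%:R * v (small (i.+1 :: mu)) +
     - h N * (large (i.+1 :: mu))%:R) = h (n - i) - h N; last by [].
  rewrite /h -[X in _ - X](cycle_mean_cst (n - i)) -/(h N) -[X in _ + X]mulN1r.
  rewrite -cycle_mean_linear; congr (_ * _); apply: eq_bigr => p _.
  by rewrite sm /large /= geA /= mul1r mulr1 mulN1r.
rewrite mulr0n add0r; apply: (@le_trans _ _ `|g (n - i)|); last by rewrite lerDl.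
have -> : g (n - i) = G (n - i) + - h N * pr (n - i) by rewrite mulNr mulrC.
rewrite -cycle_mean_linear.
rewrite le_eqVlt; apply/orP; left; apply/eqP; congr (`|_ * _|); apply: eq_bigr => p _.
by rewrite sm /large /= leNgt ltA.
Qed.

Let dist_sum n : (n <= N)%N ->
  D + \sum_(r < n) `|h r - h N| <= D + (M + 1) + N%:R * (3 * D / M).
Proof.
move=> nN; rewrite -addrA lerD2l.
have DM0 : 0 <= 3 * D / M by rewrite divr_ge0 ?mulr_ge0 // ltW.
apply: (@le_trans _ _ (\sum_(r < n) ((r%:R < M)%R%:R + 3 * D / M))).
  apply: ler_sum => r _; have [lt|ge] /= := ltP (r%:R : R) M.
    have := h_ge0 r; have := h_le1 r; have := h_ge0 N; have := h_le1 N.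
    by rewrite ler_norml; lra.
  have r0 : (0 < r)%N by rewrite -(ltr0n R) (lt_le_trans M_gt0).
  rewrite add0r; apply: le_trans (h_close r0 _) _.
    by rewrite (leq_trans _ nN) // ltnW.
  by rewrite ler_wpM2l ?mulr_ge0 // lef_pV2 ?posrE // ltr0n.
rewrite big_split /= sumr_const card_ord -[_ *+ n]mulr_natl; apply: lerD.
  case: n nN => [|n] _; first by rewrite big_ord0 addr_ge0 // ltW.
  rewrite big_ord_recl /= addrC; apply: lerD; last by case: (_ < _).
  by apply: sum_indicator_lt; rewrite ltW.
by rewrite ler_wpM2r // ler_nat.
Qed.

(** [g] vanishes below [A], so the discrete Gronwall inequality
    [n * |g n| <= sum_(r < n) |g r| + B] starts at [A] and gives the linear bound
    [B * (n / A - 1)] on the partial sums, hence [|g N| <= B / A]. *)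
Lemma large_small_cov :
  `|G N - pr N * h N| <= (D + (M + 1) + N%:R * (3 * D / M)) / A.
Proof.
set B := D + _ + _.
have B0 : 0 <= B.
  by rewrite !addr_ge0 // ?mulr_ge0 // ?invr_ge0 // ltW.
have step n : (n < N)%N ->
    n.+1%:R * `|g n.+1| <= \sum_(r < n.+1) `|g r| + B.
  by move=> nN; apply: le_trans (g_step n) _; rewrite lerD2l dist_sum.
have bound (a x S : R) : 0 < a -> a * x <= S + B -> S <= B * (a / A - 1) ->
    x <= B / A.
  move=> a0 le_x le_S; rewrite ler_pdivlMr // -(ler_pM2l a0) mulrA.
  apply: (le_trans (ler_wpM2r (ltW A_gt0) le_x)).
  have -> : a * B = (B * (a / A - 1) + B) * A by field; rewrite gt_eqF.
  by apply: ler_wpM2r; rewrite ?lerD2r // ltW.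
have gronwall n : A <= n%:R -> (n <= N)%N ->
    \sum_(r < n) `|g r| <= B * (n%:R / A - 1).
  elim: n => [|n IH] An nN; first by move: An; rewrite leNgt A_gt0.
  have [ltA|geA] := ltP (n%:R : R) A.
    rewrite big1 ?mulr_ge0 // ?subr_ge0 ?ler_pdivlMr ?mul1r // => r _.
    by rewrite g_eq0 ?normr0 // (le_lt_trans _ ltA) // ler_nat -ltnS.
  case: n => [|n] in IH An nN geA *; first by move: geA; rewrite leNgt A_gt0.
  have {}IH := IH geA (ltnW nN).
  rewrite big_ord_recr /=; have := step n (ltnW nN).
  set S := \sum_(r < n.+1) _ in IH *; set x := `|g n.+1|.
  have n0 : 0 < n.+1%:R :> R by rewrite ltr0n.
  have -> : n.+2%:R = n.+1%:R + 1 :> R by rewrite natr1.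
  move: (n.+1%:R : R) n0 IH => a a0 IH le_x.
  have {}le_x : x <= B / A by apply: bound le_x IH.
  have -> : B * ((a + 1) / A - 1) = B * (a / A - 1) + B / A by field; rewrite gt_eqF.
  exact: lerD.
have N0 : (0 < N)%N by rewrite -(ltr0n R) (lt_le_trans A_gt0).
have := step N.-1; rewrite !prednK // => /(_ (leqnn _)) le_x.
by apply: bound le_x (gronwall N AN (leqnn _)); rewrite ltr0n.
Qed.

End Independence.

(** * Merging the big cycles *)

Section Merging.
Variables (R : realType) (T : finType) (delta : R) (u : {perm T} -> R).
Hypotheses (T_gt0 : (0 < #|T|)%N) (delta_gt0 : 0 < delta).
Hypothesis u_conj : forall p s : {perm T}, u (p ^ s)%g = u p.
Hypothesis u_ge0 : forall p, 0 <= u p.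
Hypothesis u_le1 : forall p, u p <= 1.
Implicit Types p q : {perm T}.

Let D := delta * #|T|%:R.
Let small (mu : seq nat) := [seq l <- mu | l%:R < D].
Let nbig p := count (fun l => D <= l%:R) (cycle_type p).

Let D_gt0 : 0 < D.
Proof. by rewrite mulr_gt0 // ltr0n. Qed.

Lemma sumn_cycle_type p : sumn (cycle_type p) = #|T|.
Proof.
have := sum_cycle_type p (fun=> 1%N); rewrite sum1_card sumnE => ->.
by apply: eq_bigr => l _; rewrite mulr1 natn.
Qed.

Let cycle_type_small p q : (nbig p <= 1)%N -> (nbig q <= 1)%N ->
  perm_eq (small (cycle_type p)) (small (cycle_type q)) ->
  perm_eq (cycle_type p) (cycle_type q).
Proof.
pose big := fun l : nat => D <= l%:R.
have split_ct (t : {perm T}) :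
    perm_eq (cycle_type t) (seq.filter big (cycle_type t) ++ small (cycle_type t)).
  have -> : small (cycle_type t) = seq.filter (predC big) (cycle_type t).
    by apply: eq_filter => l /=; rewrite /big -ltNge.
  by rewrite perm_sym perm_filterC.
have big_nil (l : nat) : l = 0%N -> big l = false.
  by move=> ->; rewrite /big leNgt D_gt0.
have sum_ct (t : {perm T}) :
    (sumn (seq.filter big (cycle_type t)) + sumn (small (cycle_type t)) = #|T|)%N.
  by rewrite -sumn_cat -(perm_sumn (split_ct t)) sumn_cycle_type.
have big_ct (t : {perm T}) : all big (seq.filter big (cycle_type t)) by exact: filter_all.
rewrite /nbig -!size_filter -/big => np nq small_pq.
rewrite (permPl (split_ct p)) (permPr (split_ct q)).
have sum_pq := perm_sumn small_pq.
suff -> : seq.filter big (cycle_type p) = seq.filter big (cycle_type q).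
  by rewrite perm_cat2l.
have := sum_ct p; have := sum_ct q; have := big_ct p; have := big_ct q.
case: (seq.filter big (cycle_type p)) np => [|a [|]] //= _;
case: (seq.filter big (cycle_type q)) nq => [|b [|]] //= _; rewrite ?andbT.
- by move=> bb _ e1 e2; move: bb; rewrite big_nil //; lia.
- by move=> _ bb e1 e2; move: bb; rewrite big_nil //; lia.
- by move=> _ _ e1 e2; congr [:: _]; lia.
Qed.

(** The value of [u] at the permutations with small cycles [mu] and at most one
    big cycle: they are all conjugate, since the length of the big cycle is the
    number of points that [mu] leaves free. *)
Let v (mu : seq nat) : R :=
  if [pick p | (nbig p <= 1)%N && perm_eq (small (cycle_type p)) mu] is Some p
  then u p else 0.

Let v_small p : (nbig p <= 1)%N -> v (small (cycle_type p)) = u p.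
Proof.
move=> np; rewrite /v; case: pickP => [q /andP[nq /(cycle_type_small nq np)]|].
  by move=> /eq_cycle_type_conj[s ->]; rewrite u_conj.
by move=> /(_ p); rewrite np perm_refl.
Qed.

Let v_sym : symmetric_fun v.
Proof.
move=> s t st; rewrite /v; congr (if _ is Some p then _ else _).
by apply: eq_pick => p; rewrite (permPr st).
Qed.

Let w p := u p - v (small (cycle_type p)).
Let jump p := \sum_x \sum_y `|u (tperm x y * p)%g - u p|.
Let E k := \sum_(p | nbig p == k) `|w p|.

Let merge_big p x y : x \notin porbit p y ->
    D <= #|porbit p x|%:R -> D <= #|porbit p y|%:R ->
  nbig p = (nbig (tperm x y * p)%g).+1 /\
  perm_eq (small (cycle_type (tperm x y * p)%g)) (small (cycle_type p)).
Proof.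
move=> nxy Dx Dy; have e := cycle_type_merge nxy.
have Dxy : D <= (#|porbit p x| + #|porbit p y|)%:R.
  by rewrite natrD (le_trans Dx) // lerDl ler0n.
split.
  move/seq.permP: e => /(_ (fun l => D <= l%:R)) /=.
  rewrite Dx Dy Dxy /nbig; lia.
have := perm_filter (fun l => l%:R < D) e.
by rewrite /= !ltNge Dx Dy Dxy.
Qed.

Let two_big p : (1 < nbig p)%N -> exists B1 B2 : {set T},
  [/\ B1 \in porbits p, B2 \in porbits p, B1 != B2,
      D <= #|B1|%:R & D <= #|B2|%:R].
Proof.
rewrite /nbig /cycle_type count_map -size_filter => lt1.
have e : perm_eq (seq.filter (fun B : {set T} => D <= #|B|%:R) (enum (porbits p)))
    (enum [pred B : {set T} | (B \in porbits p) && (D <= #|B|%:R)]).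
  apply: uniq_perm => [||B]; [exact/filter_uniq/enum_uniq|exact: enum_uniq|].
  by rewrite mem_filter !mem_enum inE andbC.
move: lt1; rewrite (perm_size e) -cardE => /card_gt1P[B1 [B2 []]].
by rewrite !inE => /andP[? ?] /andP[? ?] ?; exists B1, B2.
Qed.

(** Merging two big cycles keeps the small ones, so [w] changes as [u] does.  The
    inequality is summed over the pairs of points that lie in two given big
    cycles, of which there are at least [D ^ 2]. *)
Let merge_point k p : nbig p = k.+2 ->
  D ^+ 2 * `|w p| <= \sum_x \sum_y
    ((nbig (tperm x y * p)%g == k.+1)%:R * `|w (tperm x y * p)%g|) + jump p.
Proof.
move=> np; have [|B1 [B2 [B1p B2p B12 D1 D2]]] := @two_big p; first by rewrite np.
have wP x y : x \in B1 -> y \in B2 ->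
    `|w p| <= (nbig (tperm x y * p)%g == k.+1)%:R * `|w (tperm x y * p)%g|
              + `|u (tperm x y * p)%g - u p|.
  move=> xB1 yB2.
  have eB1 : porbit p x = B1.
    by case/imsetP: B1p xB1 => z _ ->; rewrite -eq_porbit_mem => /eqP.
  have eB2 : porbit p y = B2.
    by case/imsetP: B2p yB2 => z _ ->; rewrite -eq_porbit_mem => /eqP.
  have [||| n_eq sm] := @merge_big p x y; rewrite ?eB1 ?eB2 //.
    by rewrite -eB2 -eq_porbit_mem eB1 eB2.
  have -> : nbig (tperm x y * p)%g == k.+1 by rewrite -eqSS -n_eq np.
  rewrite mul1r /w (v_sym sm) -[X in _ <= _ + X]normrN.
  apply: le_trans (ler_normD _ _); rewrite le_eqVlt; apply/orP; left; apply/eqP.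
  by congr (`|_|); ring.
apply: (@le_trans _ _ (\sum_(x in B1) \sum_(y in B2) `|w p|)).
  rewrite !sumr_const -mulrnA -[leRHS]mulr_natl natrM expr2.
  by rewrite ler_wpM2r // ler_pM // ltW.
rewrite /jump -big_split /= [leRHS](bigID (mem B1)) /=.
rewrite ler_wpDr //.
  by apply: sumr_ge0 => x _; rewrite addr_ge0 //; apply: sumr_ge0 => y _; rewrite ?mulr_ge0.
apply: ler_sum => x xB1; rewrite -big_split /= [leRHS](bigID (mem B2)) /=.
rewrite ler_wpDr //; last by apply: ler_sum => y; apply: wP.
by apply: sumr_ge0 => y _; rewrite addr_ge0 ?mulr_ge0.
Qed.

Let J := \sum_p jump p / #|T|%:R ^+ 2.

Let m2_gt0 : 0 < #|T|%:R ^+ 2 :> R.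
Proof. by rewrite exprn_gt0 // ltr0n. Qed.

Let J_ge0 : 0 <= J.
Proof.
apply: sumr_ge0 => p _; rewrite divr_ge0 ?(ltW m2_gt0) //.
by apply: sumr_ge0 => x _; apply: sumr_ge0.
Qed.

(** A fixed transposition permutes the permutations, so the right-hand side of
    [merge_point] sums to at most [#|T| ^ 2 * (E k.+1 + J)]. *)
Let E_step k : E k.+2 <= (E k.+1 + J) / delta ^+ 2.
Proof.
rewrite ler_pdivlMr ?exprn_gt0 // mulrC.
rewrite -(ler_pM2r m2_gt0) mulrAC -exprMn -/D mulrDl /E mulr_sumr.
apply: (@le_trans _ _ (\sum_(p | nbig p == k.+2) (\sum_x \sum_y
    ((nbig (tperm x y * p)%g == k.+1)%:R * `|w (tperm x y * p)%g|) + jump p))).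
  by apply: ler_sum => p /eqP; apply: merge_point.
have ge0 p : 0 <= \sum_x \sum_y
    ((nbig (tperm x y * p)%g == k.+1)%:R * `|w (tperm x y * p)%g|) + jump p.
  by rewrite addr_ge0 //; apply: sumr_ge0 => x _; apply: sumr_ge0 => y _; rewrite ?mulr_ge0.
apply: (@le_trans _ _ (\sum_p (\sum_x \sum_y
    ((nbig (tperm x y * p)%g == k.+1)%:R * `|w (tperm x y * p)%g|) + jump p))).
  by rewrite [leRHS](bigID (fun p => nbig p == k.+2)) /= lerDl; apply: sumr_ge0.
rewrite big_split /= /J -mulr_suml divfK ?gt_eqF // lerD2r.
rewrite exchange_big /=.
have -> : #|T|%:R ^+ 2 = \sum_(x : T) \sum_(y : T) 1 :> R.
  under eq_bigr do rewrite sumr_const.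
  by rewrite sumr_const -[RHS]mulr_natr expr2.
rewrite mulr_sumr; apply: ler_sum => x _; rewrite exchange_big mulr_sumr /=.
apply: ler_sum => y _; rewrite mulr1 [leRHS]big_mkcond /=.
rewrite (reindex_inj (mulgI (tperm x y))) /=.
by apply: ler_sum => p _; rewrite tpermKg; case: eqP; rewrite ?mul1r ?mul0r.
Qed.

(** The factor of [J] that [E_step] propagates from [E 0 = E 1 = 0]. *)
Definition merge_const (d : R) (k : nat) : R := iter k (fun a => (a + 1) / d ^+ 2) 0.

Let merge_const_ge0 k : 0 <= merge_const delta k.
Proof.
elim: k => //= k IH.
by rewrite divr_ge0 ?exprn_ge0 ?addr_ge0 // ltW.
Qed.

Let E_le k : E k <= merge_const delta k * J.
Proof.
have E01 j : (j <= 1)%N -> E j = 0.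
  by move=> j1; apply: big1 => p /eqP np; rewrite /w v_small ?subrr ?normr0 ?np.
elim: k => [|[|k] IH]; try by rewrite E01 // mulr_ge0.
apply: le_trans (E_step k) _.
rewrite [merge_const _ k.+2]/= mulrAC ler_wpM2r ?invr_ge0 ?exprn_ge0 ?(ltW delta_gt0) //.
by rewrite mulrDl mul1r lerD2r.
Qed.

Let nbig_le p K : delta^-1 <= K%:R -> (nbig p <= K)%N.
Proof.
move=> dK; rewrite -(ler_nat R); apply: le_trans dK.
rewrite -[leRHS]div1r ler_pdivlMr //.
have m0 : 0 < #|T|%:R :> R by rewrite ltr0n.
rewrite -(ler_pM2r m0) mul1r -mulrA -/D -(sumn_cycle_type p) /nbig.
elim: (cycle_type p) => [|l s IH] /=; first by rewrite mul0r.
rewrite !natrD mulrDl lerD //; have [Dl|_] := boolP (D <= l%:R).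
  by rewrite mul1r.
by rewrite mul0r.
Qed.

Lemma merging_approx K : delta^-1 <= K%:R ->
  exists v : seq nat -> R, [/\ symmetric_fun v, forall mu, 0 <= v mu,
    forall mu, v mu <= 1 &
    \sum_p `|u p - v [seq l <- cycle_type p | l%:R < delta * #|T|%:R]| <=
    (\sum_(k < K.+1) merge_const delta k) *
    (\sum_p \sum_x \sum_y `|u (tperm x y * p)%g - u p| / #|T|%:R ^+ 2)].
Proof.
move=> dK; exists v; split=> [//|mu|mu|].
- by rewrite /v; case: pickP.
- by rewrite /v; case: pickP.
have -> : \sum_p \sum_x \sum_y `|u (tperm x y * p)%g - u p| / #|T|%:R ^+ 2 = J.
  apply: eq_bigr => p _; rewrite mulr_suml; apply: eq_bigr => x _.
  by rewrite mulr_suml.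
rewrite mulr_suml; apply: (@le_trans _ _ (\sum_(k < K.+1) E k)); last exact: ler_sum.
rewrite /E; under [leRHS]eq_bigr do rewrite big_mkcond /=.
rewrite exchange_big /=; apply: ler_sum => p _.
have lt : (nbig p < K.+1)%N by rewrite ltnS nbig_le.
rewrite (bigD1 (Ordinal lt)) //= eqxx lerDl; apply: sumr_ge0 => k _.
by case: eqP.
Qed.

End Merging.

(** * The relaxation time *)

Section RelaxationTime.
Variables (R : realType) (nu : R) (nu_gt0 : 0 < nu).

Lemma leigenvalueP (T : finType) (A : 'End({ffun T -> R^o})) (a : R) :
  reflect (exists2 g : {ffun T -> R^o}, (exists x, g x != 0) &
             forall x, A g x = a * g x :> R)
          (passmx.leigenvalue A a).
Proof.
have kerE (g : {ffun T -> R^o}) :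
    g \in passmx.leigenspace A a <-> forall x, A g x = a * g x :> R.
  rewrite /passmx.leigenspace memv_ker add_lfunE opp_lfunE scale_lfunE id_lfunE.
  rewrite subr_eq0; split=> [/eqP-> x|e]; first by rewrite ffunE.
  by apply/eqP/ffunP => x; rewrite e ffunE.
apply: (iffP idP) => [nz|[g [x gx] /kerE g_ker]].
  exists (vpick (passmx.leigenspace A a)); last exact/kerE/memv_pick.
  have : vpick (passmx.leigenspace A a) != 0 by rewrite vpick0.
  move=> nz0; apply/existsP; apply: contraNT nz0 => /existsPn z.
  by apply/eqP/ffunP => x; have := z x; rewrite negbK ffunE => /eqP.
rewrite /passmx.leigenvalue; apply: contraNneq gx => e.
by move: g_ker; rewrite e memv0 => /eqP->; rewrite ffunE.
Qed.

(** An eigenvector has a nonzero component on some [E i], which forces its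
    eigenvalue to be [- lam i].  Finiteness of the set of eigenvalues is what
    makes the smallest positive one exist. *)
Lemma generator_eigenvalues (T : finType) (Q : 'End({ffun T -> R^o})) :
  (forall x y, rate Q x y = rate Q y x) ->
  exists s : seq R, forall a, passmx.leigenvalue (- Q) a -> a \in s.
Proof.
move=> symQ; have [m [lam [E [symE sumE eigE _]]]] := spectral_resolution symQ.
exists [seq - lam i | i : 'I_m] => a /leigenvalueP[g [x gx] gE].
have gQ y : \sum_z rate Q y z * g z = - a * g y.
  by rewrite -generatorE mulNr -gE opp_lfunE ffunE opprK.
have /existsP[i Ei] : [exists i, \sum_y E i x y * g y != 0].
  apply: contraNT gx => /existsPn z.
  have -> : g x = \sum_i \sum_y E i x y * g y.
    rewrite exchange_big /= (bigD1 x) //= -mulr_suml sumE eqxx mul1r big1 ?addr0 //.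
    by move=> y yx; rewrite -mulr_suml sumE eq_sym (negPf yx) mul0r.
  by rewrite big1 // => i _; have := z i; rewrite negbK => /eqP.
have key : lam i * (\sum_y E i x y * g y) = - a * (\sum_y E i x y * g y).
  transitivity (\sum_y E i x y * \sum_z rate Q y z * g z).
    rewrite mulr_sumr; under [RHS]eq_bigr do rewrite mulr_sumr.
    rewrite exchange_big /=; apply: eq_bigr => z _.
    rewrite mulrA symE -eigE mulr_suml; apply: eq_bigr => y _.
    by rewrite (symE i y) (symQ z); ring.
  by rewrite mulr_sumr; apply: eq_bigr => y _; rewrite gQ mulrCA.
by apply/mapP; exists i; rewrite ?mem_enum // (mulIf Ei key) opprK.
Qed.

Lemma interchange_genE n (u : 'S_n -> R) p :
  \sum_q rate (interchange_gen nu n) p q * u q =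
  nu * \sum_(i < n) \sum_(j < n | (i < j)%N) (u (tperm i j * p)%g - u p).
Proof.
transitivity (interchange_gen nu n [ffun q => u q : R^o] p : R).
  by rewrite generatorE; apply: eq_bigr => q _; rewrite ffunE.
rewrite lfunE /= ffunE; congr (_ * _); apply: eq_bigr => i _.
by apply: eq_bigr => j _; rewrite !ffunE.
Qed.

(** Only the transpositions that involve the point [0] move the eigenfunction
    [p |-> (p 0 == 0) - 1 / n]. *)
Lemma interchange_gap_le n :
  passmx.leigenvalue (- interchange_gen nu n.+2) (nu * n.+2%:R).
Proof.
apply/leigenvalueP.
pose g (p : 'S_n.+2) : R := (p ord0 == ord0)%:R - n.+2%:R^-1.
have n0 : n.+2%:R != 0 :> R by rewrite pnatr_eq0.
exists [ffun p => g p : R^o].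
  exists 1%g; rewrite ffunE /g perm1 eqxx mulr1n subr_eq0 eq_sym invr_eq1.
  by rewrite pnatr_eq1.
move=> p; rewrite opp_lfunE !ffunE.
rewrite [_ p]generatorE; under eq_bigr do rewrite ffunE.
rewrite interchange_genE -mulrN -mulrA; congr (_ * _).
rewrite big_ord_recl [X in _ + X]big1 => [|i _]; last first.
  apply: big1 => j ij; rewrite /g permM tpermD ?subrr //.
  by apply: contraTneq ij => ->.
rewrite addr0 big_mkcond big_ord_recl /= add0r.
transitivity (- \sum_(j < n.+1) ((p (lift ord0 j) == ord0)%:R - (p ord0 == ord0)%:R) : R).
  congr (- _); apply: eq_bigr => j _.
  by rewrite /g permM tpermL opprD addrACA opprK addNr addr0.
have : \sum_(j < n.+2) (p j == ord0)%:R = 1 :> R.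
  rewrite (bigD1 (p^-1 ord0)%g) //= permKV eqxx big1 ?addr0 // => j.
  by apply: contraNeq; rewrite pnatr_eq0 eqb0 negbK => /eqP <-; rewrite permK.
rewrite big_ord_recl sumrB sumr_const card_ord => /(canRL (addKr _)) ->.
rewrite /g mulrBr divff // -natr1 -mulr_natr; ring.
Qed.

Lemma relaxation_time_ge n :
  (nu * n.+2%:R)^-1 <= relaxation_time (interchange_chain n.+2 nu_gt0).
Proof.
set Q := interchange_gen nu n.+2.
have [s sP] := generator_eigenvalues (@interchange_rateC R nu n.+2).
pose P a := (0 < a) && passmx.leigenvalue (- Q) a.
have P0 : P (nu * n.+2%:R).
  by rewrite /P mulr_gt0 ?ltr0n // interchange_gap_le.
have mem_s a : P a -> a \in s by move=> /andP[_ /sP].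
pose F (i : 'I_(size s)) := s`_i.
have i0_lt : (index (nu * n.+2%:R)%R s < size s)%N by rewrite index_mem mem_s.
have Pi0 : P (F (Ordinal i0_lt)) by rewrite /F /= nth_index ?mem_s.
have [i Pi minF] := @Order.TotalTheory.arg_minP _ _ _ (Ordinal i0_lt) (fun i => P (F i)) F Pi0.
have minP a : P a -> F i <= a.
  move=> Pa; have lt : (index a s < size s)%N by rewrite index_mem mem_s.
  by have := minF (Ordinal lt); rewrite /F /= nth_index ?mem_s //; apply.
rewrite /relaxation_time; case: xgetP => [a _ [a0 eig_a min_a]|/(_ (F i))[]].
  have /andP[nun_gt0 eig_nun] := P0.
  have a_le := min_a _ nun_gt0 eig_nun.
  by rewrite lef_pV2.
have /andP[F0 eigF] := Pi; split=> [||a a0 eig_a]; [exact: F0|exact: eigF|].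
have Pa : P a by apply/andP; split; [exact: a0|exact: eig_a].
exact: minP Pa.
Qed.

End RelaxationTime.

(** * The semigroup of the interchange process *)

Lemma porbit_conj (T : finType) (p s : {perm T}) x :
  porbit (p ^ s)%g (s x) = s @: porbit p x.
Proof.
apply/setP => z; apply/porbitP/imsetP => [[i ->]|[y /porbitP[i ->] ->]].
  by exists ((p ^+ i)%g x); rewrite ?mem_porbit // -conjXg permJ.
by exists i; rewrite -conjXg permJ.
Qed.

Lemma cycle_type_conj (T : finType) (p s : {perm T}) :
  perm_eq (cycle_type (p ^ s)%g) (cycle_type p).
Proof.
have e : perm_eq (enum (porbits (p ^ s)%g)) [seq s @: B | B : {set T} <- enum (porbits p)].
  apply: uniq_perm => [||B]; first exact: enum_uniq.
    by rewrite map_inj_uniq ?enum_uniq //; apply/imset_inj/perm_inj.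
  rewrite mem_enum; apply/imsetP/mapP => [[x _ ->]|[B' + ->]].
    exists (porbit p (s^-1 x)%g); rewrite ?mem_enum ?imset_f //.
    by rewrite -porbit_conj permKV.
  by rewrite mem_enum => /imsetP[x _ ->]; exists (s x); rewrite ?porbit_conj.
rewrite (perm_trans (perm_map (fun B : {set T} => #|B|) e)) // -map_comp.
rewrite /cycle_type (eq_map (g := fun B : {set T} => #|B|)) // => B /=.
by rewrite card_imset //; apply: perm_inj.
Qed.

Lemma xiE (R : realType) (c : R) n (p : 'S_n.+1) :
  xi c p = has (fun l => c * n.+1%:R <= l%:R) (cycle_type p).
Proof.
apply/idP/hasP => [le_max|[l /mapP[B]]].
  have [|B Bp maxE] := @eq_bigmax_cond _ (mem (porbits p)) (fun B : {set _} => #|B|).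
    by apply/card_gt0P; exists (porbit p ord0); rewrite !inE imset_f.
  exists #|B|; first by apply/mapP; exists B; rewrite ?mem_enum.
  by move: le_max; rewrite /xi /largest_cycle maxE.
rewrite mem_enum => Bp -> le_B; apply: le_trans le_B _.
by rewrite ler_nat leq_bigmax_cond.
Qed.

Section InterchangeSemigroup.
Variables (R : realType) (nu : R) (n : nat).
Hypothesis nu_gt0 : 0 < nu.
Let Q := interchange_gen nu n.

(** Ordered pairs, unlike increasing ones, are stable under relabelling of the
    points. *)
Let sum_pairs (F : 'I_n -> 'I_n -> R) :
  (forall i j, F i j = F j i) -> (forall i, F i i = 0) ->
  \sum_i \sum_j F i j = 2 * \sum_(i < n) \sum_(j < n | (i < j)%N) F i j.
Proof.
move=> symF F0.
have split_i i : \sum_j F i j =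
    \sum_(j < n | (i < j)%N) F i j + \sum_(j < n | (j < i)%N) F i j.
  rewrite (bigID (fun j : 'I_n => (i < j)%N)) /=; congr (_ + _).
  rewrite (bigD1 i) ?ltnn //= F0 add0r; apply: eq_bigl => j.
  by rewrite -leqNgt [RHS]ltn_neqAle andbC.
under eq_bigr do rewrite split_i.
rewrite big_split /= mulr_natl mulr2n; congr (_ + _).
rewrite [LHS](exchange_big_dep xpredT) //=.
by apply: eq_bigr => i _; apply: eq_bigr => j _.
Qed.

Lemma interchange_gen_pairs (u : 'S_n -> R) p :
  \sum_q rate Q p q * u q =
  nu / 2 * \sum_x \sum_y (u (tperm x y * p)%g - u p).
Proof.
rewrite interchange_genE sum_pairs => [|i j|i].
- by rewrite mulrA divfK.
- by rewrite tpermC.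
- by rewrite tperm1 mul1g subrr.
Qed.

Lemma interchange_dirichlet (u : 'S_n -> R) :
  - (\sum_p u p * \sum_q rate Q p q * u q) =
  nu / 4 * \sum_p \sum_x \sum_y (u (tperm x y * p)%g - u p) ^+ 2.
Proof.
have -> : \sum_p u p * (\sum_q rate Q p q * u q) =
    nu / 2 * \sum_p \sum_x \sum_y u p * (u (tperm x y * p)%g - u p).
  rewrite mulr_sumr; apply: eq_bigr => p _.
  rewrite interchange_gen_pairs mulrCA; congr (_ * _).
  by rewrite mulr_sumr; apply: eq_bigr => x _; rewrite mulr_sumr.
rewrite exchange_big [in RHS]exchange_big /= -mulrN -sumrN.
have -> : nu / 2 = nu / 4 * 2 by field.
rewrite -[LHS]mulrA; congr (_ * _); rewrite mulr_sumr; apply: eq_bigr => x _.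
rewrite exchange_big [in RHS]exchange_big /= -sumrN mulr_sumr; apply: eq_bigr => y _.
have e : \sum_p u (tperm x y * p)%g ^+ 2 = \sum_p u p ^+ 2.
  by rewrite [RHS](reindex_inj (mulgI (tperm x y))).
transitivity (\sum_p (u (tperm x y * p)%g - u p) ^+ 2 +
    (\sum_p u p ^+ 2 - \sum_p u (tperm x y * p)%g ^+ 2)).
  rewrite -sumrB -big_split /= -sumrN mulr_sumr; apply: eq_bigr => p _; ring.
by rewrite e subrr addr0.
Qed.

Lemma iter_interchange_conj k (p q s : 'S_n) :
  iter k Q (indic_pt R (q ^ s)%g) (p ^ s)%g = iter k Q (indic_pt R q) p.
Proof.
elim: k p => [|k IH] p /=.
  by rewrite !ffunE (inj_eq (conjg_inj s)).
rewrite !generatorE !interchange_gen_pairs; congr (_ * _).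
rewrite (reindex_inj (@perm_inj _ s)) /=; apply: eq_bigr => x _.
rewrite (reindex_inj (@perm_inj _ s)) /=; apply: eq_bigr => y _.
by rewrite -tpermJ -conjMg !IH.
Qed.

Lemma transition_conj t (p q s : 'S_n) :
  transition Q t (p ^ s)%g (q ^ s)%g = transition Q t p q.
Proof.
rewrite /transition; congr (limn (series _)); apply/funext => k.
by rewrite iter_interchange_conj.
Qed.

(** The energy bound controls the sum of the squared jumps; [e] is the parameter
    of the inequality [|d| <= e + d ^ 2 / e]. *)
Lemma interchange_jump_bound (f u : 'S_n -> R) (t e : R) :
  (0 < n)%N -> 0 < t -> 0 < e ->
  (forall p, 0 <= f p <= 1) ->
  (forall p, u p = \sum_q transition Q t p q * f q) ->
  \sum_p \sum_x \sum_y `|u (tperm x y * p)%g - u p| / n%:R ^+ 2 <=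
  n`!%:R * (e + 2 / (nu * t * e * n%:R ^+ 2)).
Proof.
move=> n0 t0 e0 f01 uE.
have [m [lam [E [symE sumE eigE posE]]]] := spectral_resolution (@interchange_rateC R nu n).
have := transition_dirichlet (@interchange_rateC R nu n) symE sumE eigE t0
  (fun i => posE i f) uE.
rewrite interchange_dirichlet; set S2 := \sum_p _ => le_S2.
have {le_S2} le_S2 : S2 <= 2 / (nu * t) * n`!%:R.
  have le_f2 : \sum_p f p ^+ 2 <= n`!%:R.
    rewrite -card_Sn -sumr_const; apply: ler_sum => p _.
    by have /andP[f0 f1] := f01 p; rewrite expr_le1.
  have c0 : 0 < nu / 4 by rewrite divr_gt0.
  rewrite -(ler_pM2l c0); apply: le_trans le_S2 _.
  have -> : nu / 4 * (2 / (nu * t) * n`!%:R) = (2 * t)^-1 * n`!%:R.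
    by field; rewrite !gt_eqF.
  by rewrite ler_wpM2l // invr_ge0 mulr_ge0 // ltW.
have n20 : 0 < n%:R ^+ 2 :> R by rewrite exprn_gt0 // ltr0n.
have amgm (d : R) : `|d| <= e + d ^+ 2 / e.
  have [|lt] := leP `|d| e; first by move=> h; rewrite (le_trans h) // lerDl divr_ge0 ?sqr_ge0 // ltW.
  rewrite (le_trans _ (_ : d ^+ 2 / e <= _)) ?lerDr ?(ltW e0) //.
  by rewrite ler_pdivlMr // -real_normK ?num_real // expr2 ler_wpM2l // ltW.
have -> : n`!%:R * (e + 2 / (nu * t * e * n%:R ^+ 2)) =
    (n`!%:R * n%:R ^+ 2 * e + 2 / (nu * t) * n`!%:R / e) / n%:R ^+ 2.
  by field; rewrite !gt_eqF // ltr0n.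
have -> : \sum_p \sum_x \sum_y `|u (tperm x y * p)%g - u p| / n%:R ^+ 2 =
    (\sum_p \sum_x \sum_y `|u (tperm x y * p)%g - u p|) / n%:R ^+ 2.
  by rewrite mulr_suml; apply: eq_bigr => p _; rewrite mulr_suml;
     apply: eq_bigr => x _; rewrite mulr_suml.
rewrite ler_pM2r ?invr_gt0 //.
apply: (@le_trans _ _ (\sum_p \sum_x \sum_y (e + (u (tperm x y * p)%g - u p) ^+ 2 / e))).
  by apply: ler_sum => p _; apply: ler_sum => x _; apply: ler_sum.
have -> : \sum_p \sum_x \sum_y (e + (u (tperm x y * p)%g - u p) ^+ 2 / e) =
    n`!%:R * n%:R ^+ 2 * e + S2 / e.
  rewrite /S2 mulr_suml.
  have -> : n`!%:R * n%:R ^+ 2 * e = \sum_(p : 'S_n) \sum_(x < n) \sum_(y < n) e.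
    rewrite !sumr_const !card_ord card_Sn -!mulrnA -[RHS]mulr_natr !natrM.
    by move: (n`!%:R : R) (n%:R : R) => a b; ring.
  rewrite -big_split /=; apply: eq_bigr => p _.
  rewrite mulr_suml -big_split /=; apply: eq_bigr => x _.
  by rewrite mulr_suml -big_split.
by rewrite lerD2l ler_pM2r // invr_gt0.
Qed.

End InterchangeSemigroup.

(** * The covariance of the semigroup *)

Section CovarianceBound.
Variables (R : realType) (nu c : R) (n' : nat).
Hypotheses (nu_gt0 : 0 < nu) (c_gt0 : 0 < c) (c_lt1 : c < 1).
Let n := n'.+1.
Let Q := interchange_gen nu n.

(** The two terms of the bound come from replacing [u] by the function [v] of the
    cycles shorter than [eta ^ 2 * n], and from the covariance of [f] and [v].
    In the latter the numbers of points below [eta * n] are discarded, which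
    explains the choice [delta = eta ^ 2]. *)
Lemma interchange_cov_bound (f : 'S_n -> R) (t alpha eta e : R) (K : nat) :
  0 < alpha -> alpha / (nu * n%:R) <= t ->
  (forall p q, 0 <= transition Q t p q) ->
  (forall p, \sum_q transition Q t p q = 1) ->
  0 < eta -> eta <= c -> 0 < e -> (eta ^+ 2)^-1 <= K%:R ->
  (forall p, f p = (xi c p)%:R) ->
  `|(\sum_p \sum_q f p * f q * transition Q t p q) / n`!%:R
    - ((\sum_p f p) / n`!%:R) ^+ 2| <=
  (\sum_(k < K.+1) merge_const (eta ^+ 2) k) * (e + 2 / (alpha * e * n%:R))
  + (eta ^+ 2 + 4 * eta + n%:R^-1) / c.
Proof.
move=> al0 le_t T_ge0 T_sum eta0 eta_c e0 etaK fE.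
have n0 : 0 < n%:R :> R by rewrite ltr0n.
have N0 : 0 < n`!%:R :> R by rewrite ltr0n fact_gt0.
have t0 : 0 < t by apply: lt_le_trans le_t; rewrite divr_gt0 // mulr_gt0.
have f01 p : 0 <= f p <= 1 by rewrite fE ler0n lern1 leq_b1.
have symT p q : transition Q t p q = transition Q t q p.
  have [m [lam [E [symE sumE eigE _]]]] := spectral_resolution (@interchange_rateC R nu n).
  exact: (transition_sym symE sumE eigE).
pose u p := \sum_q transition Q t p q * f q.
have u_ge0 p : 0 <= u p.
  by apply: sumr_ge0 => q _; rewrite mulr_ge0 //; case/andP: (f01 q).
have u_le1 p : u p <= 1.
  rewrite -(T_sum p); apply: ler_sum => q _.
  by rewrite ler_piMr //; case/andP: (f01 q).
have f_ct p : f p = (has (fun l => c * n%:R <= l%:R) (cycle_type p))%:R.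
  by rewrite fE xiE.
have f_conj p s : f (p ^ s)%g = f p.
  by rewrite !f_ct (perm_has _ (cycle_type_conj p s)).
have u_conj p s : u (p ^ s)%g = u p.
  rewrite /u (reindex_inj (conjg_inj s)) /=; apply: eq_bigr => q _.
  by rewrite transition_conj f_conj.
have u_sum : \sum_p u p = \sum_p f p.
  rewrite exchange_big /=; apply: eq_bigr => q _; rewrite -mulr_suml.
  by under eq_bigr do rewrite symT; rewrite T_sum mul1r.
pose delta := eta ^+ 2.
have de0 : 0 < delta by rewrite exprn_gt0.
have T0 : (0 < #|'I_n|)%N by rewrite card_ord.
have [v [v_sym v_ge0 v_le1]] := merging_approx T0 de0 u_conj u_ge0 u_le1 etaK.
rewrite card_ord; set W := \sum_p `|u p - _|; set Cst := \sum_(k < K.+1) _ => le_W.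
have Cst0 : 0 <= Cst.
  apply: sumr_ge0 => k _; elim: (k : nat) => [|j IH] //=.
  by rewrite divr_ge0 ?addr_ge0 // ltW // exprn_gt0.
pose sm (p : 'S_n) := v [seq l <- cycle_type p | l%:R < delta * n%:R].
pose F := (\sum_p f p) / n`!%:R.
have F01 : 0 <= F <= 1.
  apply/andP; split.
    by rewrite divr_ge0 ?ler0n // sumr_ge0 // => p _; case/andP: (f01 p).
  rewrite ler_pdivrMr // mul1r -card_Sn -sumr_const.
  by apply: ler_sum => p _; case/andP: (f01 p).
have -> : (\sum_p \sum_q f p * f q * transition Q t p q) / n`!%:R - F ^+ 2 =
   (\sum_p (f p - F) * (u p - sm p)) / n`!%:R + (\sum_p (f p - F) * sm p) / n`!%:R.
  rewrite -mulrDl -big_split /=.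
  have -> : \sum_p ((f p - F) * (u p - sm p) + (f p - F) * sm p) =
      \sum_p f p * u p - F * \sum_p u p.
    by rewrite mulr_sumr -sumrB; apply: eq_bigr => p _; ring.
  rewrite u_sum mulrBl expr2 mulrA; congr (_ / _ - _).
  apply: eq_bigr => p _; rewrite mulr_sumr; apply: eq_bigr => q _; ring.
apply: le_trans (ler_normD _ _) _; apply: lerD.
  rewrite normrM (ger0_norm (x := _^-1)) ?invr_ge0 ?ler0n //.
  rewrite ler_pdivrMr //; apply: (@le_trans _ _ W).
    apply: le_trans (ler_norm_sum _ _ _) _; apply: ler_sum => p _.
    rewrite normrM ler_piMl //; have := f01 p; have := F01.
    move=> /andP[? ?] /andP[? ?]; rewrite ler_norml; apply/andP; split; lra.
  apply: le_trans le_W _; rewrite -[leRHS]mulrA ler_wpM2l //.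
  apply: le_trans (interchange_jump_bound nu_gt0 (isT : (0 < n)%N) t0 e0 f01 (fun p => erefl (u p))) _.
  rewrite mulrC ler_wpM2r ?ler0n // lerD2l ler_wpM2l //.
  rewrite lef_pV2 ?posrE ?mulr_gt0 ?exprn_gt0 //.
  move: le_t; rewrite ler_pdivrMr ?mulr_gt0 // => le_t.
  have -> : nu * t * e * n%:R ^+ 2 = t * (nu * n%:R) * (e * n%:R) by ring.
  by rewrite -mulrA ler_wpM2r // mulr_ge0 // ltW.
have A0 : 0 < c * n%:R by rewrite mulr_gt0.
have DA : delta * n%:R <= c * n%:R.
  rewrite ler_pM2r // /delta expr2 (le_trans _ eta_c) // ler_piMl ?(ltW eta0) //.
  by rewrite (le_trans eta_c) // ltW.
have AN : c * n%:R <= n%:R by rewrite ler_piMl // ltW.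
have M0 : 0 < eta * n%:R by rewrite mulr_gt0.
have D0 : 0 <= delta * n%:R by rewrite mulr_ge0 // ltW.
have := large_small_cov D0 A0 DA v_sym v_ge0 v_le1 M0 AN.
have -> : (delta * n%:R + (eta * n%:R + 1) + n%:R * (3 * (delta * n%:R) / (eta * n%:R))) /
    (c * n%:R) = (eta ^+ 2 + 4 * eta + n%:R^-1) / c.
  by rewrite /delta; field; rewrite !gt_eqF.
apply: le_trans; rewrite le_eqVlt; apply/orP; left; apply/eqP; congr (`|_|).
rewrite /cycle_mean.
under eq_bigr do rewrite mulrBl.
rewrite sumrB mulrBl -mulr_sumr; congr (_ - _).
  by rewrite mulrC; congr (_ * _); apply: eq_bigr => p _; rewrite f_ct.
rewrite /F -[LHS]mulrA; congr (_ * _); last by rewrite mulrC.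
by rewrite mulrC; congr (_ * _); apply: eq_bigr => p _; rewrite f_ct.
Qed.

End CovarianceBound.

(** * From the process to its semigroup *)

Section StationaryLaw.
Variables (R : realType) (T : finType) (C : reversible_chain R T).
Variables (d : measure_display) (Omega : measurableType d).
Variables (P : probability Omega R) (X : R -> Omega -> T).
Hypothesis statX : stationary_version C P X.
Variables (t : R) (t_ge0 : 0 <= t).

Let event x y := [set w | X 0 w = x /\ X t w = y]%classic.

Let measurable_event x y : measurable (event x y).
Proof.
have [mX _] := statX.
have -> : event x y = ([set w | X 0 w = x] `&` [set w | X t w = y])%classic by [].
by apply: measurableI; apply: mX.
Qed.

Let event_law x y : P (event x y) = (stationary C x * transition C t x y)%:E.
Proof.
have [_ lawX] := statX.
have := lawX x [:: (t, y)]; rewrite /= t_ge0 subr0 mulr1 => <- //.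
congr (P _); apply/seteqP; split=> w /= [Xx Xy]; split=> //.
  by move=> p; rewrite inE => /eqP->.
by apply: (Xy (t, y)); rewrite inE.
Qed.

Let pair_event (phi : rel T) := [set w | phi (X 0 w) (X t w)]%classic.

Let pair_eventE phi : pair_event phi =
  (\bigcup_(xy in [set` [seq xy : T * T <- enum {: T * T} | phi xy.1 xy.2]])
     event xy.1 xy.2)%classic.
Proof.
apply/seteqP; split=> [w /= phi_w|w [[x y] /= xy_in [/= Xx Xy]]].
  by exists (X 0 w, X t w) => //=; rewrite mem_filter phi_w mem_enum.
by move: xy_in; rewrite mem_filter /= -Xx -Xy => /andP[].
Qed.

Lemma measurable_pair_event phi : measurable (pair_event phi).
Proof.
rewrite pair_eventE; apply: fin_bigcup_measurable; first exact: finite_seq.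
by move=> xy _; apply: measurable_event.
Qed.

Lemma pair_event_law phi : P (pair_event phi) =
  (\sum_x \sum_y (phi x y)%:R * (stationary C x * transition C t x y))%:E.
Proof.
rewrite pair_eventE; set r := [seq xy <- _ | _].
have r_fin : finite_set [set` r] by exact: finite_seq.
have r_triv : trivIset [set` r] (fun xy => event xy.1 xy.2).
  by move=> [x y] [x' y'] _ _ [w [[/= <- <-] [<- <-]]].
rewrite (measure_fin_bigcup _ r_fin r_triv) => [|xy _]; last exact: measurable_event.
have r_uniq : uniq r by exact/filter_uniq/enum_uniq.
rewrite -fsbig_seq // /r.
rewrite big_filter big_enum_cond /= pair_big /= -sumEFin big_mkcond /=.
apply: eq_bigr => -[x y] _ /=; rewrite event_law.
by case: (phi x y); rewrite ?mul1r ?mul0r.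
Qed.

(** Nonnegativity and total mass [1] of the transition kernel are read off the
    existence of the process rather than off the exponential series. *)
Lemma transition_ge0 x y : 0 < stationary C x -> 0 <= transition C t x y.
Proof.
move=> st0; rewrite -(pmulr_rge0 _ st0) -lee_fin -event_law.
exact: measure_ge0.
Qed.

Lemma transition_sum1 x : 0 < stationary C x -> \sum_y transition C t x y = 1.
Proof.
move=> st0; have [_ lawX] := statX.
have := pair_event_law (fun x' _ => x' == x).
have -> : pair_event (fun x' _ => x' == x) =
    [set w | X 0 w = x /\ forall p, p \in ([::] : seq (R * T)) -> X p.1 w = p.2]%classic.
  by apply/seteqP; split=> w /=; [move/eqP|case=> /eqP].
rewrite lawX // mulr1 => -[e].
apply: (mulfI (lt0r_neq0 st0)); rewrite mulr1 {2}e [RHS](bigD1 x) //= eqxx.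
rewrite [X in _ = _ + X]big1 ?addr0; last first.
  by move=> x' /negPf nx; apply: big1 => y _; rewrite nx mul0r.
by rewrite mulr_sumr; apply: eq_bigr => y _; rewrite mul1r.
Qed.

Lemma stationary_covariance (f : pred T) :
  covariance P (fun w => (f (X 0 w))%:R) (fun w => (f (X t w))%:R) =
  (\sum_x \sum_y (f x && f y)%:R * (stationary C x * transition C t x y)
   - (\sum_x \sum_y (f x)%:R * (stationary C x * transition C t x y))
   * (\sum_x \sum_y (f y)%:R * (stationary C x * transition C t x y)))%:E.
Proof.
pose phi1 := [rel x _ | f x] : rel T; pose phi2 := [rel _ y | f y] : rel T.
pose phi12 := [rel x y | f x && f y] : rel T.
have indE (phi : rel T) : (fun w => (phi (X 0 w) (X t w))%:R) = \1_(pair_event phi) :> (Omega -> R).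
  by apply/funext => w; rewrite indicE mem_setE.
have ind1 : (fun w => (f (X 0 w))%:R) = \1_(pair_event phi1) :> (Omega -> R) by exact: indE.
have ind2 : (fun w => (f (X t w))%:R) = \1_(pair_event phi2) :> (Omega -> R) by exact: indE.
have ind12 : \1_(pair_event phi1) * \1_(pair_event phi2) = \1_(pair_event phi12) :> (Omega -> R).
  by rewrite -!indE; apply/funext => w; rewrite -mulnb natrM.
have Lfun_ind (phi : rel T) : \1_(pair_event phi) \in Lfun P 1.
  by apply/Lfun1_integrable/integrable_indic/measurable_pair_event.
rewrite ind1 ind2 covarianceE ?ind12 // !expectation_indic;
  try exact: measurable_pair_event.
by rewrite !pair_event_law.
Qed.

End StationaryLaw.

Lemma relaxation_time_ge0 (R : realType) (T : finType) (C : reversible_chain R T) :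
  0 <= relaxation_time C.
Proof.
rewrite /relaxation_time invr_ge0; case: xgetP => [a _ [/ltW]|] //.
Qed.

(** * Noise sensitivity *)

Theorem theorem1p4 (R : realType) (nu : R) (nu_gt0 : 0 < nu)
    (c : R) (c_gt0 : 0 < c) (c_lt1 : c < 1) :
  noise_sensitive (fun n : nat => interchange_chain n nu_gt0) (xi c).
Proof.
move=> alpha al0 d Omega P X statX.
pose t n := alpha * relaxation_time (interchange_chain n nu_gt0).
have t_ge0 n : 0 <= t n by rewrite mulr_ge0 ?relaxation_time_ge0 // ltW.
have t_ge n : alpha / (nu * n.+2%:R) <= t n.+2.
  by rewrite ler_wpM2l ?relaxation_time_ge // ltW.
pose T n := transition (interchange_gen nu n) (t n).
have st_gt0 n (p : 'S_n) : 0 < stationary (interchange_chain n nu_gt0) p.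
  by rewrite /= invr_gt0 ltr0n; apply/card_gt0P; exists p.
have T_ge0 n p q : 0 <= T n p q.
  exact: (transition_ge0 (statX n) (t_ge0 n) _ (st_gt0 n p)).
have T_sum n p : \sum_q T n p q = 1.
  exact: (transition_sum1 (statX n) (t_ge0 n) (st_gt0 n p)).
pose f n (p : 'S_n) : R := (xi c p)%:R.
pose r n := (\sum_p \sum_q f n p * f n q * T n p q) / n`!%:R
   - ((\sum_p f n p) / n`!%:R) ^+ 2.
have covE n : covariance (P n) (fun w => (xi c (X n 0 w))%:R)
    (fun w => (xi c (X n (t n) w))%:R) = (r n)%:E.
  have symT p q : T n p q = T n q p.
    have [m [lam [E [symE sumE eigE _]]]] := spectral_resolution (@interchange_rateC R nu n).
    exact: (transition_sym symE sumE eigE).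
  have T_sum_l q : \sum_p T n p q = 1.
    by under eq_bigr do rewrite symT; apply: T_sum.
  rewrite (stationary_covariance (statX n) (t_ge0 n) (@xi R c n)) /= card_Sn; congr _%:E.
  rewrite /r expr2; congr (_ - _ * _).
  - rewrite mulr_suml; apply: eq_bigr => p _; rewrite mulr_suml.
    by apply: eq_bigr => q _; rewrite -mulnb natrM mulrCA mulrC.
  - rewrite mulr_suml; apply: eq_bigr => p _.
    by rewrite -mulr_sumr -mulr_sumr T_sum mulr1.
  - rewrite exchange_big mulr_suml; apply: eq_bigr => q _ /=.
    by rewrite -mulr_sumr -mulr_sumr T_sum_l mulr1.
suff : ((fun n => (r n)%:E) @ \oo --> 0%E)%classic.
  by rewrite -(funext covE).
apply: cvg_EFin; first exact: nearW.
apply/cvgr0Pnorm_le => eps eps0.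
(* [5 * eta / c] and each of the three other error terms are at most [eps / 4]. *)
pose eta := Num.min c (eps * c / 20).
have eta0 : 0 < eta by rewrite lt_min c_gt0 divr_gt0 // mulr_gt0.
have eta_c : eta <= c by rewrite ge_min lexx.
have eta_eps : eta <= eps * c / 20 by rewrite ge_min lexx orbT.
pose K := (Num.bound (eta ^+ 2)^-1).
have etaK : (eta ^+ 2)^-1 <= K%:R.
  by apply/ltW/archi_boundP; rewrite invr_ge0 sqr_ge0.
pose Cst : R := \sum_(k < K.+1) merge_const (eta ^+ 2) k.
have Cst0 : 0 <= Cst.
  apply: sumr_ge0 => k _; elim: (k : nat) => [|j IH] //=.
  by rewrite divr_ge0 ?addr_ge0 ?sqr_ge0.
pose e := eps / (4 * (Cst + 1)).
have C1 : 0 < Cst + 1 by rewrite ltr_pwDr.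
have e0 : 0 < e by rewrite divr_gt0 // mulr_gt0.
near=> n.
have n2 : (2 <= n)%N by near: n; exact: nbhs_infty_ge.
have big1 : 8 * Cst / (alpha * e * eps) <= n%:R by near: n; exact: nbhs_infty_ger.
have big2 : 4 / (eps * c) <= n%:R by near: n; exact: nbhs_infty_ger.
have [m nE] : exists m, n = m.+2 by move: n2; case: (n) => [|[|m]] // _; exists m.
rewrite {}nE in big1 big2 *.
have := @interchange_cov_bound R nu c m.+1 nu_gt0 c_gt0 c_lt1 (f m.+2) (t m.+2) alpha eta e K al0
  (t_ge m) (T_ge0 m.+2) (T_sum m.+2) eta0 eta_c e0 etaK (fun p => erefl).
move=> /le_trans; apply; rewrite -/Cst.
have n0 : 0 < m.+2%:R :> R by rewrite ltr0n.
move: (m.+2%:R : R) n0 big1 big2 => x x0 big1 big2.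
have h1 : Cst * e <= eps / 4.
  rewrite /e mulrA ler_pdivrMr ?mulr_gt0 //.
  have -> : eps / 4 * (4 * (Cst + 1)) = Cst * eps + eps by field.
  by rewrite lerDl ltW.
have h2 : Cst * (2 / (alpha * e * x)) <= eps / 4.
  have den0 : 0 < alpha * e * x by rewrite mulr_gt0 // mulr_gt0.
  rewrite mulrA (ler_pdivrMr _ _ den0).
  have den1 : 0 < alpha * e * eps by rewrite mulr_gt0 // mulr_gt0.
  move: big1; rewrite (ler_pdivrMr _ _ den1) => big1.
  have -> : eps / 4 * (alpha * e * x) = (x * (alpha * e * eps)) / 4 by field.
  by rewrite ler_pdivlMr //; apply: le_trans big1; lra.
have h3 : (eta ^+ 2 + 4 * eta) / c <= eps / 4.
  rewrite ler_pdivrMr //.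
  have : eta ^+ 2 <= eta.
    by rewrite expr2 ler_piMl ?(ltW eta0) // (le_trans eta_c) // ltW.
  have -> : eps / 4 * c = 5 * (eps * c / 20) by field.
  lra.
have h4 : x^-1 / c <= eps / 4.
  move: big2; rewrite ler_pdivrMr ?mulr_gt0 // => big2.
  rewrite ler_pdivrMr // -[leLHS]mul1r ler_pdivrMr //.
  have -> : eps / 4 * c * x = x * (eps * c) / 4 by field.
  by rewrite ler_pdivlMr // mul1r.
rewrite mulrDr [X in _ + X]mulrDl.
lra.
Unshelve. all: by end_near.
Qed.
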